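(* Assume that for all $u,v,x\in\mathbb{R}^d$: $\mathbb{E}_\xi\|\tilde\nabla f(u,\xi)-\tilde\nabla f(v,\xi)\|^2\le L_f^2\|u-v\|^2$, $\mathbb{E}_\xi\|\tilde\nabla f(x,\xi)-\nabla f(x)\|^2\le V^2$, and $f(x)\ge 0$. Run the stochastic linearized augmented Lagrangian algorithm described in the context, with the parameters $\rho,\eta_k,\alpha_k$ given there, for the problem $\min_{x\in\mathbb{R}^d} f(x)$ subject to $Ax=b$. Then $K=\widetilde O(\varepsilon^{-3})$ iterations suffice for an $\varepsilon$-stationary output in expectation: there are constants $C,p>0$ independent of $\varepsilon$ such that for every $\varepsilon\in(0,1/2]$ there is an integer $K\le C\varepsilon^{-3}(\log(1/\varepsilon))^p$ for which the output $(\bar x,\bar\lambda)$ of the algorithm after $K$ iterations satisfies $$\mathbb{E}\|\nabla f(\bar x)+A^\top\bar\lambda\|\le\varepsilon\quad\text{and}\quad \mathbb{E}\|A\bar x-b\|\le\varepsilon .$$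
   Context: Problem: $f:\mathbb{R}^d\to\mathbb{R}$ is differentiable, $f(x)=\mathbb{E}_\xi[\tilde f(x,\xi)]$ with $\xi\sim P_\Xi$; $A\in\mathbb{R}^{p_0\times d}$ is nonzero, $b\in\mathbb{R}^{p_0}$, and $Ax=b$ is feasible. A stochastic gradient oracle $\tilde\nabla f(x,\xi)$ with $\mathbb{E}_\xi[\tilde\nabla f(x,\xi)]=\nabla f(x)$ is available. $\delta>0$ is the smallest nonzero eigenvalue of $A^\top A$; $\|A\|$ is the spectral norm; $L_f>0$. Algorithm: $x_0,\lambda_0,g_0$ are arbitrary (deterministic). For $k=0,1,\dots$: $x_{k+1}=x_k-\eta_{k+1}\big(g_k+A^\top\lambda_k+\rho A^\top(Ax_k-b)\big)$; $\lambda_{k+1}=\lambda_k+\rho(Ax_{k+1}-b)$; draw $\xi_{k+1}\sim P_\Xi$ independently of the past and set $g_{k+1}=\tilde\nabla f(x_{k+1},\xi_{k+1})+(1-\alpha_{k+1})\big(g_k-\tilde\nabla f(x_k,\xi_{k+1})\big)$. Output after $K$ iterations: $(\bar x,\bar\lambda)=(x_{\hat k},\lambda_{\hat k})$ with $\hat k$ uniform on $\{1,\dots,K\}$, independent of the run. Parameters: for fixed arbitrary positive constants $c_1,c_2,c_3,c_4$, $c=121L_f^2$, $m=\min\big(\frac{1}{448L_f},\frac{1}{32(1+c_2+c_3)L_f},\frac{1}{8(1+2c_3)L_f}\big)$, $\rho=\max\big(\frac{7(1+c_1)}{m\delta},\frac{4(6+c_4)(1+c_1)L_f}{\delta},\frac{168(1+c_1)L_f}{\delta}\big)$,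 $\eta=\frac{1}{11(L_f+\rho\|A\|^2)}$, $k_0=\max\big((\frac{10m}{3c_1\eta})^2,(\frac{20}{3\eta c_2L_f})^2,(\frac{10}{3\eta c_3L_f})^2,\frac{400}{3\eta^2c_4L_f^2},(\frac{20}{c\eta^2})^4,(\frac{50}{3c\eta^2})^6,2\big)$, $\eta_k=\frac{\eta}{(k+k_0)^{1/3}\log(k+k_0)}$, $\alpha_k=c\eta_k^2$. *)

(* Defs.v *)
From HB Require Import structures.
From mathcomp Require Import all_boot all_order all_algebra.
From mathcomp Require Import all_classical all_reals all_analysis.

Set Implicit Arguments.
Unset Strict Implicit.
Unset Printing Implicit Defensive.

Import Order.TTheory GRing.Theory Num.Theory.
Import numFieldNormedType.Exports.

Local Open Scope classical_set_scope.
Local Open Scope ring_scope.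

(* The library norm `|v| on matrices is the max norm, hence this definition. *)
Definition enorm (R : realType) (n : nat) (v : 'cV[R]_n) : R :=
  Num.sqrt (\sum_(i < n) v i ord0 ^+ 2).

Definition spectral_norm (R : realType) (m n : nat) (A : 'M[R]_(m, n)) : R :=
  sup [set enorm (A *m v) | v in [set v : 'cV[R]_n | enorm v <= 1]].

(* `eigenvalue` is about row eigenvectors; this is used for symmetric matrices
   only, where row and column eigenvalues are the same. *)
Definition smallest_nonzero_eigenvalue (R : realType) (n : nat)
    (S : 'M[R]_n) (delta : R) : Prop :=
  [/\ eigenvalue S delta, delta != 0 &
      forall a : R, eigenvalue S a -> a != 0 -> delta <= a].

Definition gradient (R : realType) (n : nat) (f : 'cV[R]_n -> R)
    (x : 'cV[R]_n) : 'cV[R]_n :=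
  \col_(i < n) 'D_(delta_mx i ord0) f x.

Notation borel_cV R n := (g_sigma_algebraType (@open 'cV[R]_n)).

(* The oracle G is a random field: it has to be jointly measurable for the
   iterates to be random variables. *)
Definition jointly_measurable (R : realType) (n : nat) (d : measure_display)
    (Xi : measurableType d) (G : 'cV[R]_n -> Xi -> 'cV[R]_n) : Prop :=
  measurable_fun [set: borel_cV R n * Xi]
    (fun p : borel_cV R n * Xi => G p.1 p.2 : borel_cV R n).

Record state (R : realType) (p n : nat) := State {
  primal : 'cV[R]_n;
  dual : 'cV[R]_p;
  direction : 'cV[R]_n }.

Definition slalm_step (R : realType) (p n : nat) (Xi : Type)
    (A : 'M[R]_(p, n)) (b : 'cV[R]_p) (G : 'cV[R]_n -> Xi -> 'cV[R]_n)
    (rho eta alpha : R) (xi : Xi) (s : state R p n) : state R p n :=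
  let: State x l g := s in
  let x' := x - eta *: (g + A^T *m l + rho *: (A^T *m (A *m x - b))) in
  let l' := l + rho *: (A *m x' - b) in
  let g' := G x' xi + (1 - alpha) *: (g - G x xi) in
  State x' l' g'.

(* Samples are numbered from 0: xi k is the sample drawn in iteration k, that
   is, the one usually written with index k + 1, like eta_ and alpha_. *)
Fixpoint slalm (R : realType) (p n : nat) (Xi : Type)
    (A : 'M[R]_(p, n)) (b : 'cV[R]_p) (G : 'cV[R]_n -> Xi -> 'cV[R]_n)
    (rho : R) (eta_ alpha_ : nat -> R) (s0 : state R p n) (xi : nat -> Xi)
    (k : nat) : state R p n :=
  if k is k'.+1 then
    slalm_step A b G rho (eta_ k) (alpha_ k) (xi k')
      (slalm A b G rho eta_ alpha_ s0 xi k')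
  else s0.

Definition indep_systems (R : realType) (d : measure_display)
    (Omega : measurableType d) (P : probability Omega R)
    (F H : set (set Omega)) : Prop :=
  forall E E', F E -> H E' -> P (E `&` E') = (P E * P E')%E.

Definition sample_sequence (R : realType) (d d' : measure_display)
    (Omega : measurableType d) (P : probability Omega R)
    (Xi : measurableType d') (PXi : probability Xi R)
    (xi : nat -> {mfun Omega >-> Xi}) : Prop :=
  (forall k B, measurable B -> distribution P (xi k) B = PXi B) /\
  (forall k, indep_systems P (g_sigma_algebra_preimage (xi k))
                             (g_sigma_preimage (fun i : 'I_k => xi i))).

(* An index that is uniform on {1, ..., K} and independent of the whole sample
   sequence, hence of the run, whose initial state is deterministic. *)
Definition uniform_output_index (R : realType) (d d' : measure_display)
    (Omega : measurableType d) (P : probability Omega R)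
    (Xi : measurableType d') (xi : nat -> {mfun Omega >-> Xi})
    (K : nat) (khat : {mfun Omega >-> nat}) : Prop :=
  (forall j : nat, (1 <= j <= K)%N ->
     P (khat @^-1` [set j]) = (K%:R^-1)%:E) /\
  indep_systems P (g_sigma_algebra_preimage khat)
    <<s \bigcup_k g_sigma_algebra_preimage (xi k) >>.

(* Main.v *)
Require Import Defs.
From HB Require Import structures.
From mathcomp Require Import all_boot all_order all_algebra.
From mathcomp Require Import all_classical all_reals all_analysis.
From mathcomp Require Import measurable_realfun complex ring lra.

(** The proof follows a Lyapunov function through the run. Write [x], [l], [g]
    for the primal iterate, the multiplier and the gradient estimator,
    [r = A x - b] for the residual, [e = g - grad f x] for the error of the
    estimator and [v] for the search direction, so that a primal step adds
    [eta v] to [x].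

    A primal step is an inexact gradient step on the augmented Lagrangian and
    decreases it by about [eta / 2 |v|^2], up to [eta / 2 |e|^2]; the dual step
    then increases it by [rho |r|^2] ([lagrangian_descent]). The increment of
    [A^T l] is [q = rho A^T r]. Because [r] lies in the range of [A], on which
    [A^T] is bounded below by the smallest nonzero eigenvalue of [A^T A]
    ([spectral_gap]), the choice of [rho] makes the ascent [rho |r|^2] at most
    [m / 7 |q|^2]. The primal update expresses [q] through [v - v'], where [v']
    is the previous direction, up to lower order terms; the inner product of
    this identity with [m v] produces the decrease [m / 2 |v - v'|^2], which
    dominates [3 m / 7 |v - v'|^2] ([pathwise_descent]).

    The error of the recursive momentum estimator contracts by the factor
    [1 - alpha] per step, plus centred noise of size [|x1 - x|] and [alpha]
    ([momentum_error]). Weighted by [1 / (8 L^2 eta)], it absorbs the terms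
    [eta / 2 |e|^2]. Here the current sample is averaged out with the past
    frozen, by independence ([past_average]). Since [eta] tends to zero and
    [1 / eta] grows slowly, all other terms are of lower order from some
    iteration on, and the expected potential decreases up to errors of order
    [eta^3] ([mean_potential_recursion]), which are summable because of the
    logarithm in the step size ([step_cubes]).

    The potential is not obviously bounded below, but the sums of [dotv l r]
    telescope from below through the dual update, so the sums of the potential
    are bounded below, and an almost decreasing sequence with this property is
    bounded below itself ([sum_decrease_le]). The expected decreases are hence
    summable, which bounds the sums of the expected squares of the stationarity
    measure and of the residual over [K] iterations by [C / eta_K]
    ([ergodic_bound]); finitely many initial iterations only enter through
    moments that are bounded uniformly over all probability spaces
    ([run_moments]). Averaging over the random output index ([output_mean])
    and choosing [K] of order [(ln (1/eps) / eps)^3] ([iteration_count])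
    completes the proof. *)

Set Implicit Arguments.
Unset Strict Implicit.
Unset Printing Implicit Defensive.

Import Order.TTheory GRing.Theory Num.Theory.
Import numFieldNormedType.Exports.

Local Open Scope classical_set_scope.
Local Open Scope ring_scope.

(** * Euclidean vectors *)

Definition dotv (R : realType) n (u v : 'cV[R]_n) : R :=
  \sum_(i < n) u i ord0 * v i ord0.

Definition nsq (R : realType) n (u : 'cV[R]_n) : R := dotv u u.

Section euclidean.
Context {R : realType}.
Implicit Types n : nat.

Lemma coordB n (u v : 'cV[R]_n) i :
  (u - v) i ord0 = u i ord0 - v i ord0.
Proof. by rewrite !mxE. Qed.

Lemma dotvC n (u v : 'cV[R]_n) : dotv u v = dotv v u.
Proof. by apply: eq_bigr => i _; rewrite mulrC. Qed.

Lemma dotvDl n (u v w : 'cV[R]_n) : dotv (u + v) w = dotv u w + dotv v w.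
Proof. by rewrite -big_split; apply: eq_bigr => i _; rewrite mxE mulrDl. Qed.

Lemma dotvZl n a (u w : 'cV[R]_n) : dotv (a *: u) w = a * dotv u w.
Proof. by rewrite mulr_sumr; apply: eq_bigr => i _; rewrite mxE mulrA. Qed.

Lemma dotvNl n (u w : 'cV[R]_n) : dotv (- u) w = - dotv u w.
Proof. by rewrite -scaleN1r dotvZl mulN1r. Qed.

Lemma dotvDr n (u v w : 'cV[R]_n) : dotv w (u + v) = dotv w u + dotv w v.
Proof. by rewrite dotvC dotvDl !(dotvC w). Qed.

Lemma dotvZr n a (u w : 'cV[R]_n) : dotv w (a *: u) = a * dotv w u.
Proof. by rewrite dotvC dotvZl dotvC. Qed.

Lemma dotvNr n (u w : 'cV[R]_n) : dotv w (- u) = - dotv w u.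
Proof. by rewrite dotvC dotvNl dotvC. Qed.

Definition dotvE := (dotvDl, dotvDr, dotvZl, dotvZr, dotvNl, dotvNr).

Lemma dotv_mulmx m n (A : 'M[R]_(m, n)) u v :
  dotv (A *m u) v = dotv u (A^T *m v).
Proof.
transitivity (\sum_i \sum_j A i j * u j ord0 * v i ord0).
  by apply: eq_bigr => i _; rewrite mxE mulr_suml.
rewrite exchange_big; apply: eq_bigr => j _ /=; rewrite mxE mulr_sumr.
by apply: eq_bigr => i _; rewrite mxE mulrA [u j _ * _]mulrC.
Qed.

Lemma nsq_ge0 n (u : 'cV[R]_n) : 0 <= nsq u.
Proof. by apply: sumr_ge0 => i _; rewrite -expr2 sqr_ge0. Qed.

Lemma enorm_ge0 n (u : 'cV[R]_n) : 0 <= enorm u.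
Proof. exact: sqrtr_ge0. Qed.

Lemma sqr_enorm n (u : 'cV[R]_n) : enorm u ^+ 2 = nsq u.
Proof.
rewrite sqr_sqrtr; last by apply: sumr_ge0 => i _; rewrite sqr_ge0.
by apply: eq_bigr => i _; rewrite expr2.
Qed.

Lemma sqr_coord_le n (u : 'cV[R]_n) i : u i ord0 ^+ 2 <= nsq u.
Proof.
rewrite /nsq /dotv (bigD1 i) //= -expr2 lerDl.
by apply: sumr_ge0 => j _; rewrite -expr2 sqr_ge0.
Qed.

(** The square of [t u - v] is nonnegative. *)
Lemma dotv_young n t (u v : 'cV[R]_n) :
  2 * t * dotv u v <= t ^+ 2 * nsq u + nsq v.
Proof.
have := nsq_ge0 (t *: u - v); rewrite /nsq !dotvE (dotvC v u); nra.
Qed.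

Lemma dotv_cauchy n (u v : 'cV[R]_n) : dotv u v ^+ 2 <= nsq u * nsq v.
Proof.
have [u0|] := eqVneq (nsq u) 0.
  suff -> : dotv u v = 0 by rewrite u0 mul0r expr0n.
  apply: big1 => i _.
  have : u i ord0 ^+ 2 <= 0 by rewrite -u0 sqr_coord_le.
  by rewrite le_eqVlt ltNge sqr_ge0 orbF sqrf_eq0 => /eqP ->; rewrite mul0r.
move=> u0; have up : 0 < nsq u by rewrite lt_def u0 nsq_ge0.
have := dotv_young (dotv u v / nsq u) u v.
rewrite -(ler_pM2l up).
have -> : nsq u * (2 * (dotv u v / nsq u) * dotv u v) = 2 * dotv u v ^+ 2.
  by field.
have -> : nsq u * ((dotv u v / nsq u) ^+ 2 * nsq u + nsq v)
  = dotv u v ^+ 2 + nsq u * nsq v by field.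
lra.
Qed.

Lemma dotv_cauchy_enorm n (u v : 'cV[R]_n) : dotv u v <= enorm u * enorm v.
Proof.
apply: le_trans (ler_norm _) _.
rewrite -ler_sqr ?nnegrE ?mulr_ge0 ?enorm_ge0 // real_normK ?num_real //.
by rewrite exprMn !sqr_enorm dotv_cauchy.
Qed.

Lemma nsqZ n a (u : 'cV[R]_n) : nsq (a *: u) = a ^+ 2 * nsq u.
Proof. by rewrite /nsq dotvZl dotvZr mulrA expr2. Qed.

Lemma nsqN n (u : 'cV[R]_n) : nsq (- u) = nsq u.
Proof. by rewrite /nsq dotvNl dotvNr opprK. Qed.

Lemma nsqD n (u v : 'cV[R]_n) : nsq (u + v) <= 2 * nsq u + 2 * nsq v.
Proof.
have := nsq_ge0 (u - v); rewrite /nsq !dotvE (dotvC v u); lra.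
Qed.

Lemma nsqD3 n (u v w : 'cV[R]_n) :
  nsq (u + v + w) <= 3 * nsq u + 3 * nsq v + 3 * nsq w.
Proof.
have := nsq_ge0 (u - v); have := nsq_ge0 (u - w); have := nsq_ge0 (v - w).
rewrite /nsq !dotvE (dotvC v u) (dotvC w u) (dotvC w v); lra.
Qed.

Definition frob_sq m n (A : 'M[R]_(m, n)) : R := \sum_i \sum_j A i j ^+ 2.

Lemma frob_ge0 m n (A : 'M[R]_(m, n)) : 0 <= frob_sq A.
Proof. by do 2 (apply: sumr_ge0 => ? _); rewrite sqr_ge0. Qed.

Lemma frob_tr m n (A : 'M[R]_(m, n)) : frob_sq A^T = frob_sq A.
Proof.
by rewrite /frob_sq exchange_big; do 2 (apply: eq_bigr => ? _); rewrite mxE.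
Qed.

Lemma nsq_mulmx m n (A : 'M[R]_(m, n)) u : nsq (A *m u) <= frob_sq A * nsq u.
Proof.
rewrite /frob_sq mulr_suml; apply: ler_sum => i _; rewrite -expr2.
have -> : (A *m u) i ord0 = dotv (row i A)^T u.
  by rewrite mxE; apply: eq_bigr => j _; rewrite !mxE.
apply: le_trans (dotv_cauchy _ _) _; rewrite ler_wpM2r ?nsq_ge0 //.
by apply: ler_sum => j _; rewrite !mxE expr2.
Qed.

Lemma nsq_mulmx_tr m n (A : 'M[R]_(m, n)) u : nsq (A^T *m u) <= frob_sq A * nsq u.
Proof. by rewrite -frob_tr; exact: nsq_mulmx. Qed.

End euclidean.

(** * The spectral gap on the range of a matrix *)

Section spectral_gap.
Context {R : realType}.
Local Open Scope sesquilinear_scope.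
Local Notation C := (R[i]).
Local Notation toC := (real_complex R).

(** A symmetric real matrix is unitarily diagonalizable over the complex numbers,
    with real eigenvalues. In an eigenbasis the inequality reads
    [delta s <= s^2] for each eigenvalue [s], and [s] is zero or at least
    [delta]. *)
Lemma spectral_gap_sym n (S : 'M[R]_n) (delta : R) (x : 'cV[R]_n) :
  S^T = S -> 
  (forall a, eigenvalue S a -> a != 0 -> 0 < delta <= a) ->
  delta * dotv x (S *m x) <= nsq (S *m x).
Proof.
move=> symS gap.
pose SC : 'M[C]_n := map_mx toC S.
have conjR (r : R) : Num.conj (toC r) = toC r by exact: conjc_real.
have trS : SC^t* = SC.
  apply/matrixP => i j; rewrite !mxE conjR; congr toC.
  by rewrite -[in RHS]symS mxE.
have herS : SC \is hermsymmx.
  by apply/is_hermitianmxP; rewrite expr0 scale1r trS.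
pose P := spectralmx SC; pose D := spectral_diag SC.
have PU : P \is unitarymx by exact: spectral_unitarymx.
have Pu := unitarymx_unit PU.
have SE : SC = invmx P *m diag_mx D *m P.
  exact/orthomx_spectralP/hermitian_normalmx.
have rowP0 j : row j P != 0.
  apply/eqP => e; have : row j (P *m invmx P) = 0 by rewrite row_mul e mul0mx.
  rewrite mulmxV // row1 => /rowP /(_ j); rewrite !mxE !eqxx => /eqP.
  by rewrite oner_eq0.
have DR j : exists2 r : R, D ord0 j = toC r & (r == 0) || (0 < delta <= r).
  have Dr : D ord0 j \is Num.real.
    by move/mxOverP: (hermitian_spectral_diag_real herS); apply.
  have [r rE] : exists r, D ord0 j = toC r by apply/complex_realP.
  exists r => //; case: eqVneq => //= r0; apply: gap => //.
  have : eigenvalue SC (toC r).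
    apply/eigenvalueP; exists (row j P) => //.
    rewrite SE -row_mul !mulmxA mulmxV // mul1mx row_mul -rE.
    by rewrite row_diag_mx -scalemxAl -rowE.
  by rewrite eigenvalue_map.
pose u : 'cV[C]_n := map_mx toC x; pose z := P *m u.
have ut : u^t* = u^T by apply/matrixP => i j; rewrite !mxE conjR.
have dotC (a b : 'cV[R]_n) :
    toC (dotv a b) = (((map_mx toC a)^T) *m map_mx toC b) ord0 ord0.
  rewrite mxE rmorph_sum; apply: eq_bigr => i _.
  by rewrite !mxE rmorphM.
have mS (a : 'cV[R]_n) : map_mx toC (S *m a) = SC *m map_mx toC a.
  by rewrite map_mxM.
have zE : z^t* = u^T *m invmx P.
  by rewrite /z trmx_mul map_mxM ut invmx_unitary.
have quad (E : 'rV[C]_n) :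
    (z^t* *m diag_mx E *m z) ord0 ord0 = \sum_j E ord0 j * `|z j ord0| ^+ 2.
  rewrite mxE; apply: eq_bigr => j _.
  by rewrite mul_mx_diag !mxE normCKC mulrA [_ * E _ _]mulrC -!mulrA.
have Sx1 : toC (dotv x (S *m x)) = \sum_j D ord0 j * `|z j ord0| ^+ 2.
  by rewrite dotC mS -quad zE SE /z !mulmxA.
have Sx2 : toC (nsq (S *m x)) = \sum_j D ord0 j ^+ 2 * `|z j ord0| ^+ 2.
  pose E : 'rV[C]_n := \row_j (D ord0 j ^+ 2).
  transitivity (\sum_j E ord0 j * `|z j ord0| ^+ 2); last first.
    by apply: eq_bigr => j _; rewrite mxE.
  have symSC : SC^T = SC by rewrite /SC map_trmx symS.
  have DD : diag_mx D *m diag_mx D = diag_mx E.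
    by rewrite mulmx_diag; congr diag_mx; apply/rowP => j; rewrite !mxE expr2.
  rewrite -quad -DD zE /nsq dotC !mS trmx_mul symSC {1 2}SE !mulmxA mulmxK //.
rewrite -subr_ge0 -(@lecR R) rmorphB rmorphM /= Sx1 Sx2 mulr_sumr -sumrB.
rewrite sumr_ge0 // => j _; have [r rE hr] := DR j.
rewrite rE [toC delta * (_ * _)]mulrA -mulrBl mulr_ge0 // ?exprn_ge0 //.
rewrite -rmorphXn -rmorphM -rmorphB lecR.
case/orP: hr => [/eqP -> |/andP[d0 dr]].
  by rewrite expr0n /= mulr0 subr0.
by rewrite expr2 -mulrBl mulr_ge0 ?subr_ge0 // (le_trans (ltW d0)).
Qed.

(** With [S = A^T A], [x^T S x] is [|A x|^2] and [S x] is [A^T] applied to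
    [A x]. *)
Lemma spectral_gap m n (A : 'M[R]_(m, n)) (delta : R) (x : 'cV[R]_n) :
  smallest_nonzero_eigenvalue (A^T *m A) delta ->
  0 < delta /\ delta * nsq (A *m x) <= nsq (A^T *m (A *m x)).
Proof.
move=> [ev d0 dmin].
have dp : 0 < delta.
  rewrite lt_def d0 /=; case/eigenvalueP: ev => v vE v0.
  have vv : 0 < nsq v^T.
    rewrite lt_def nsq_ge0 andbT; apply: contraNneq v0 => h.
    apply/eqP/rowP => j; apply/eqP; rewrite mxE -sqrf_eq0 eq_le sqr_ge0 andbT.
    by have := sqr_coord_le v^T j; rewrite h mxE.
  have : delta * nsq v^T = nsq (A *m v^T).
    rewrite /nsq dotv_mulmx mulmxA -dotvZr; congr dotv.
    by have /(congr1 trmx) := vE; rewrite linearZ /= !trmx_mul trmxK.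
  move=> h; rewrite -(pmulr_lge0 _ vv) h; exact: nsq_ge0.
split=> //; rewrite mulmxA.
have -> : nsq (A *m x) = dotv x (A^T *m A *m x).
  by rewrite /nsq dotv_mulmx mulmxA.
apply: spectral_gap_sym; first by rewrite trmx_mul trmxK.
by move=> a ea a0; rewrite dp dmin.
Qed.

End spectral_gap.

(** * Smooth functions *)

Section smoothness.
Context {R : realType} (n : nat) (f : 'cV[R]_n -> R).
Hypothesis f_diff : forall x, differentiable f x.

Lemma derive_dotv x v : 'D_v f x = dotv (gradient f x) v.
Proof.
rewrite deriveE //.
have {1}-> : v = \sum_i v i ord0 *: delta_mx i ord0.
  rewrite {1}[v]matrix_sum_delta; apply: eq_bigr => i _.
  by rewrite big_ord_recl big_ord0 addr0.
rewrite linear_sum; apply: eq_bigr => i _.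
by rewrite linearZ /= mxE deriveE // mulrC.
Qed.

Lemma is_derive_line x v (t : R) :
  is_derive t 1 (fun t => f (x + t *: v)) (dotv (gradient f (x + t *: v)) v).
Proof.
have E : (fun h : R => h^-1 *: (((fun t => f (x + t *: v)) \o shift t) (h *: 1)
              - f (x + t *: v)))
       = (fun h : R => h^-1 *: ((f \o shift (x + t *: v)) (h *: v)
              - f (x + t *: v))).
  apply/funext => h /=; congr (_ *: (f _ - _)).
  by rewrite /shift /= [h%:A]mulr1 scalerDl addrCA.
split.
  by rewrite /derivable E; exact: (@diff_derivable _ _ _ f _ v).
by rewrite -derive_dotv /derive E.
Qed.

Lemma mean_value x v : exists2 t, 0 <= t <= 1 &
  f (x + v) - f x = dotv (gradient f (x + t *: v)) v.
Proof.
have [||t t01] := @MVT_segment R (fun t => f (x + t *: v))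
  (fun t => dotv (gradient f (x + t *: v)) v) 0 1 ler01.
- by move=> t _; exact: is_derive_line.
- apply: derivable_within_continuous => t _.
  by have := is_derive_line x v t => -[].
rewrite scale1r scale0r addr0 subr0 mulr1 => fE; exists t => //.
Qed.

(** The mean value theorem on a segment suffices, at the price of the constant
    [L] instead of [L / 2]. *)
Lemma descent (L : R) : 0 <= L ->
  (forall u v, nsq (gradient f u - gradient f v) <= L ^+ 2 * nsq (u - v)) ->
  forall x v, f (x + v) <= f x + dotv (gradient f x) v + L * nsq v.
Proof.
move=> L0 lip x v; have [t /andP[t0 t1] fE] := mean_value x v.
have lipt : enorm (gradient f (x + t *: v) - gradient f x) <= L * enorm v.
  rewrite -ler_sqr ?nnegrE ?mulr_ge0 ?enorm_ge0 // exprMn !sqr_enorm.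
  apply: le_trans (lip _ _) _; rewrite ler_wpM2l ?sqr_ge0 //.
  rewrite addrAC subrr add0r nsqZ ler_piMl ?nsq_ge0 //.
  by rewrite expr_le1.
have := dotv_cauchy_enorm (gradient f (x + t *: v) - gradient f x) v.
rewrite dotvDl dotvNl => cs.
have := ler_wpM2r (enorm_ge0 v) lipt; rewrite -mulrA -expr2 sqr_enorm.
lra.
Qed.

End smoothness.

Lemma lipschitz_continuous (R : realType) n (h : 'cV[R]_n -> R) (K : R) :
  (forall u v, (h u - h v) ^+ 2 <= K * nsq (u - v)) -> continuous h.
Proof.
move=> lip x; apply/(@cvgrPdist_lt _ _ _ (nbhs x) (nbhs_filter x)) => e e0.
pose K' := `|K| * n%:R + 1.
have K1 : 1 <= K' by rewrite /K' lerDr mulr_ge0.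
have K0 : 0 < K' by apply: lt_le_trans K1.
apply/(@nbhs_normP R 'cV[R]_n); exists (e / K'); first exact: divr_gt0.
move=> y /= xy.
have nn : nsq (x - y) <= n%:R * `|x - y| ^+ 2.
  rewrite mulr_natl -[X in _ *+ X]card_ord -sumr_const.
  apply: ler_sum => i _; rewrite -expr2 -real_normK ?num_real //.
  rewrite ler_sqr ?nnegrE // [leRHS]/Num.norm /= mx_normrE.
  by apply/bigmax_geP; right => /=; exists (i, ord0)=> //; rewrite !mxE.
rewrite -ltr_sqr ?nnegrE ?(ltW e0) // real_normK ?num_real //.
apply: le_lt_trans (lip _ _) _.
have : `|x - y| ^+ 2 < (e / K') ^+ 2.
  by rewrite ltr_sqr ?nnegrE // ltW // divr_gt0.
rewrite exprMn exprVn ltr_pdivlMr ?exprn_gt0 // => h1.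
apply: le_lt_trans _ h1.
apply: le_trans (_ : K * nsq (x - y) <= `|K| * (n%:R * `|x - y| ^+ 2)) _.
  apply: le_trans (ler_wpM2r (nsq_ge0 _) (ler_norm K)) _.
  by rewrite ler_wpM2l.
rewrite mulrA [leRHS]mulrC ler_wpM2r ?sqr_ge0 //.
rewrite expr2; apply: (@le_trans _ _ K'); first by rewrite lerDl.
by rewrite ler_peMr // ltW.
Qed.

(** * Borel vectors and independence *)

Section borel.
Context {R : realType}.

Lemma continuous_measurable_borel_cV n (h : 'cV[R]_n -> R) :
  continuous h -> measurable_fun setT (h : borel_cV R n -> R).
Proof.
move=> ch; apply: (measurability _ (RGenOInfty.measurableE R)).
move=> /= _ [_ [a ->] <-]; rewrite setTI; apply: sub_sigma_algebra.
by move/continuousP : ch; apply; exact: rray_open.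
Qed.

Lemma measurable_coord n i :
  measurable_fun setT (fun v : borel_cV R n => (v : 'cV[R]_n) i ord0).
Proof. by apply: continuous_measurable_borel_cV; exact: coord_continuous. Qed.

(** An open set is the union of the boxes with rational centre and radius
    [1 / k] that it contains, and there are countably many of them. *)
Lemma measurable_cV d (T : measurableType d) n (X : T -> 'cV[R]_n) :
  (forall i, measurable_fun setT (fun t => X t i ord0)) ->
  measurable_fun setT (X : T -> borel_cV R n).
Proof.
move=> mX; apply: (@measurability _ _ _ (borel_cV R n) _ _ open) => //.
move=> _ [U oU <-]; rewrite setTI.
pose box (z : 'cV[rat]_n * nat) : set 'cV[R]_n :=
  [set v | forall i, `|v i ord0 - ratr (z.1 i ord0)| < z.2.+1%:R^-1].
have -> : X @^-1` U = \bigcup_(z : 'cV[rat]_n * nat)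
    (if `[< box z `<=` U >] then X @^-1` box z else set0).
  apply/seteqP; split=> t; last first.
    by case=> z _; case: ifPn => // /asboolP zU /= /zU.
  move=> /= tU; have /nbhs_ballP[e /= e0 eU] : nbhs (X t) U by exact: open_nbhs_nbhs.
  have [k ke] : exists k : nat, 2 * k.+1%:R^-1 < e.
    exists (Num.truncn (2 / e)); rewrite ltr_pdivrMr // -ltr_pdivrMl // mulrC.
    by have := truncnS_gt (2 / e).
  have k0 : 0 < k.+1%:R^-1 :> R by rewrite invr_gt0.
  have [r1 r1E] : exists r1 : R, r1 = k.+1%:R^-1 by exists k.+1%:R^-1.
  rewrite -r1E in k0 ke.
  have dense (x : R) : exists q : rat, `|x - ratr q| < r1.
    have /rat_in_itvoo[q] : x - r1 < x + r1 by lra.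
    rewrite in_itv /= => /andP[q1 q2]; exists q.
    by rewrite ltr_norml; apply/andP; split; lra.
  pose q : 'cV[rat]_n := \col_i xget 0 [set q | `|X t i ord0 - ratr q| < r1].
  have qX : box (q, k) (X t).
    move=> i /=; rewrite mxE -r1E; case: xgetP => [_ _ //|no].
    by have [r /no] := dense (X t i ord0).
  exists (q, k) => //=; rewrite asboolT // => u uq; apply: eU.
  split=> // i j; rewrite (ord1 j); have := uq i; have := qX i.
  rewrite /ball /= -r1E !ltr_norml => /andP[? ?] /andP[? ?].
  by apply/andP; split; lra.
apply: countable_bigcupT_measurable; first exact: countableP.
move=> z; case: ifP => // _.
have -> : X @^-1` box z = \bigcap_(i : 'I_n) 
    (fun t => X t i ord0) @^-1`
      `](ratr (z.1 i ord0) - z.2.+1%:R^-1), (ratr (z.1 i ord0) + z.2.+1%:R^-1)[%classic.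
  apply/seteqP; split=> t h i.
    by move=> _; have := h i; rewrite /= ltr_norml in_itv /=;
      move: (_^-1) => r /andP[? ?]; apply/andP; split; lra.
  have /= := h i I; rewrite in_itv /= ltr_norml.
  by move: (_^-1) => r /andP[? ?]; apply/andP; split; lra.
apply: fin_bigcap_measurable => // i _.
by rewrite -[X in measurable X]setTI; exact: mX.
Qed.

End borel.

Section independence.
Context {R : realType} {d d1 d2} {Omega : measurableType d}
  {T1 : measurableType d1} {T2 : measurableType d2}
  (P : probability Omega R) (Q : probability T2 R)
  (X : Omega -> T1) (Y : Omega -> T2).
Hypotheses (mX : measurable_fun setT X) (mY : measurable_fun setT Y).
Local Open Scope ereal_scope.
Hypothesis indep : forall A B, measurable A -> measurable B ->
  P (X @^-1` A `&` Y @^-1` B) = P (X @^-1` A) * Q B.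

(** The joint law of independent variables is the product of their laws, so
    that the second one can be averaged out first. *)
Lemma integral_indep (h : T1 * T2 -> \bar R) :
  measurable_fun setT h -> (forall z, 0 <= h z) ->
  \int[P]_w h (X w, Y w) = \int[P]_w \int[Q]_y h (X w, y).
Proof.
move=> mh h0.
pose XM : {mfun Omega >-> T1} := HB.pack X (isMeasurableFun.Build _ _ _ _ _ mX).
have mXY : measurable_fun setT (fun w => (X w, Y w)) by exact: measurable_fun_pair.
pose XY : {mfun Omega >-> (T1 * T2)%type} :=
  HB.pack (fun w => (X w, Y w)) (isMeasurableFun.Build _ _ _ _ _ mXY).
transitivity (\int[distribution P XY]_z h z).
  by rewrite ge0_integral_pushforward.
transitivity (\int[distribution P XM \x Q]_z h z).
  apply: eq_measure_integral => A mA _; apply/esym/product_measure_unique => //.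
rewrite fubini_tonelli1 // ge0_integral_pushforward //.
  exact: measurable_fun_fubini_tonelli_F.
by move=> x _; exact: integral_ge0.
Qed.

End independence.

(** * Step sizes and the number of iterations *)

Section logarithms.
Context {R : realType}.
Implicit Types x y t : R.

Lemma ln_ge_half t : 2 <= t -> 1 / 2 <= ln t.
Proof.
move=> t2.
have := @le_ln1Dx R (- (1 / 2)) ltac:(lra).
have -> : 1 + - (1 / 2) = 2^-1 :> R by field.
rewrite lnV ?posrE // => h.
have : ln 2 <= ln t by rewrite ler_ln ?posrE //; lra.
by lra.
Qed.

Lemma ln_succ_le t : 0 < t -> ln (t + 1) <= ln t + 1 / t.
Proof.
move=> t0.
have -> : t + 1 = t * (1 + 1 / t) by field; rewrite gt_eqF.
have i0 : 0 < 1 / t by rewrite divr_gt0.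
rewrite lnM ?posrE ?addr_gt0 // lerD2l le_ln1Dx //.
by apply: lt_trans i0; rewrite ltrN10.
Qed.

Lemma ln_succ_ge t : 0 < t -> ln t + 1 / (t + 1) <= ln (t + 1).
Proof.
move=> t0; have t10 : 0 < t + 1 by lra.
have -> : ln t = ln (t + 1) + ln (1 + - (1 / (t + 1))).
  rewrite -lnM ?posrE //; last first.
    by rewrite subr_gt0 ltr_pdivrMr // mul1r; lra.
  by congr ln; field; rewrite gt_eqF.
have := @le_ln1Dx R (- (1 / (t + 1))).
rewrite ltrN2 ltr_pdivrMr // mul1r => /(_ ltac:(lra)).
by lra.
Qed.

Lemma powR_invrn x n : 0 <= x -> (0 < n)%N -> (x `^ (n%:R^-1)) ^+ n = x.
Proof.
move=> x0 n0; rewrite -powR_mulrn ?powR_ge0 // -powRrM mulVf ?powRr1 //.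
by rewrite pnatr_eq0 -lt0n.
Qed.

End logarithms.

Section step_sizes.
Context {R : realType} (eta k0 : R) (eta_ : nat -> R).
Hypotheses (eta_gt0 : 0 < eta) (k0_ge2 : 2 <= k0).
Hypothesis etaE : forall k : nat,
  eta_ k = eta / ((k%:R + k0) `^ (1 / 3) * ln (k%:R + k0)).

Let T (k : nat) : R := k%:R + k0.
Let s (k : nat) : R := T k `^ (1 / 3).
Let l (k : nat) : R := ln (T k).

Let k0_ge0 : 0 <= k0.
Proof. by move: k0_ge2; lra. Qed.

Let T_ge2 k : 2 <= T k.
Proof. by rewrite /T -[2]add0r lerD. Qed.

Let T_gt0 k : 0 < T k.
Proof. by have := T_ge2 k; lra. Qed.

Let TS k : T k.+1 = T k + 1.
Proof. by rewrite /T -natr1 addrAC. Qed.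

Let s3 k : s k ^+ 3 = T k.
Proof. by rewrite /s div1r powR_invrn // ltW. Qed.

Let s_gt0 k : 0 < s k.
Proof. exact: powR_gt0. Qed.

Let l_ge k : 1 / 2 <= l k.
Proof. exact: ln_ge_half. Qed.

Let l_gt0 k : 0 < l k.
Proof. by have := l_ge k; lra. Qed.

Let sl_gt0 k : 0 < s k * l k.
Proof. exact: mulr_gt0. Qed.

Let s_mono k : s k <= s k.+1.
Proof.
rewrite -(@ler_pXn2r _ 3) ?nnegrE ?(ltW (s_gt0 _)) // !s3 TS; lra.
Qed.

Let l_mono k : l k <= l k.+1.
Proof. by rewrite /l ler_ln ?posrE // TS; lra. Qed.

Lemma step_gt0 k : 0 < eta_ k.
Proof. by rewrite etaE divr_gt0 //; exact: sl_gt0. Qed.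

Lemma step_inv k : 1 / eta_ k = s k * l k / eta.
Proof. by rewrite etaE div1r invf_div. Qed.

Lemma step_nonincr k : eta_ k.+1 <= eta_ k.
Proof.
rewrite !etaE ler_pM2l // lef_pV2 ?posrE //; [|exact: sl_gt0..].
by apply: ler_pM (s_mono k) (l_mono k); exact/ltW.
Qed.

Lemma step_le i j : (i <= j)%N -> eta_ j <= eta_ i.
Proof.
elim: j => [|j IH]; first by rewrite leqn0 => /eqP ->.
rewrite leq_eqVlt ltnS => /orP[/eqP -> //|/IH]; apply: le_trans.
exact: step_nonincr.
Qed.

Lemma step_small kappa : 0 < kappa ->
  exists N, forall k, (N <= k)%N -> eta_ k <= kappa.
Proof.
move=> kp; exists (Num.truncn ((2 * eta / kappa) ^+ 3)).+1 => k Nk.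
have u0 : 0 < 2 * eta / kappa by rewrite divr_gt0 ?mulr_gt0.
have su : 2 * eta / kappa <= s k.
  rewrite -(@ler_pXn2r _ 3) ?nnegrE ?(ltW (s_gt0 _)) ?(ltW u0) // s3.
  apply: le_trans (ltW (truncnS_gt _)) _.
  apply: (@le_trans _ _ k%:R); rewrite ?ler_nat // /T lerDl.
  by move: k0_ge2; lra.
rewrite etaE -/(T k) -/(s k) -/(l k) ler_pdivrMr ?sl_gt0 //.
move: su; rewrite ler_pdivrMr // => su.
have : 1 / 2 * (s k * kappa) <= l k * (s k * kappa).
  by rewrite ler_pM2r ?mulr_gt0.
by lra.
Qed.

(** [1 / eta_k] grows like [k^(1/3) ln k], so its increments are of order
    [k^(-2/3) ln k], while [eta_k] itself is of order [k^(-1/3) / ln k]. *)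
Lemma step_inv_increment kappa : 0 < kappa ->
  exists N, forall k, (N <= k)%N ->
    1 / eta_ k.+1 - 1 / eta_ k <= kappa * eta_ k.+1.
Proof.
move=> kp; pose B := 624 / (kappa * eta ^+ 2).
have B0 : 0 < B by rewrite divr_gt0 ?ltr0n // mulr_gt0 // exprn_gt0.
exists (Num.truncn (B ^+ 6)).+1 => k Nk.
(* In terms of this twelfth root [q], the logarithm is at most [12 q], while
   the cube root is [q^4], so the logarithm squared is negligible. *)
pose q := T k.+1 `^ (12%:R^-1).
have q12 : q ^+ 12 = T k.+1 by rewrite /q powR_invrn // ltW.
have q0 : 0 < q by exact: powR_gt0.
have q1 : 1 <= q.
  rewrite -(@ler_pXn2r _ 12) ?nnegrE ?(ltW q0) // q12 expr1n.
  by have := T_ge2 k.+1; lra.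
have sq : s k.+1 = q ^+ 4.
  apply/eqP; rewrite -(@eqrXn2 _ 3) ?(ltW (s_gt0 _)) ?exprn_ge0 ?(ltW q0) //.
  by rewrite s3 -exprM q12.
have lq : l k.+1 <= 12 * q.
  by rewrite /l -q12 lnXn // -[_ *+ 12]mulr_natl ler_pM2l // ltW // ln_sublinear.
have qB : B <= q ^+ 2.
  rewrite -(@ler_pXn2r _ 6) ?nnegrE ?exprn_ge0 ?(ltW q0) ?(ltW B0) //.
  rewrite -exprM q12; apply: le_trans (ltW (truncnS_gt _)) _.
  apply: (@le_trans _ _ k.+1%:R); first by rewrite ler_nat ltnW.
  by rewrite /T lerDl; move: k0_ge2; lra.
have su := s_mono k; have lu := l_mono k.
have sp := s_gt0 k; have sp' := s_gt0 k.+1; have lp := l_gt0 k.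
have lp' := l_gt0 k.+1.
have s2 : s k.+1 <= 2 * s k.
  rewrite -(@ler_pXn2r _ 3) ?nnegrE ?mulr_ge0 ?ltW // exprMn !s3 TS.
  by have := T_ge2 k; lra.
have ds : (s k.+1 - s k) * s k ^+ 2 <= 1.
  have -> : 1 = (s k.+1 - s k) * (s k.+1 ^+ 2 + s k.+1 * s k + s k ^+ 2).
    transitivity (s k.+1 ^+ 3 - s k ^+ 3); last by ring.
    by rewrite !s3 TS; ring.
  rewrite ler_wpM2l ?subr_ge0 // lerDr addr_ge0 ?sqr_ge0 //.
  by rewrite mulr_ge0 ?ltW.
have dl : (l k.+1 - l k) * s k ^+ 3 <= 1.
  have := ln_succ_le (T_gt0 k); rewrite -TS -/(l k) -/(l k.+1) s3 => h.
  by rewrite -ler_pdivlMr //; lra.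
rewrite !step_inv -mulrBl ler_pdivrMr // etaE -/(T _) -/(s _) -/(l _).
have -> : kappa * (eta / (s k.+1 * l k.+1)) * eta
    = kappa * eta ^+ 2 / (s k.+1 * l k.+1) by field; rewrite !gt_eqF.
rewrite ler_pdivlMr ?sl_gt0 //.
have s20 : 0 < s k ^+ 2 by rewrite exprn_gt0.
have inc : (s k.+1 * l k.+1 - s k * l k) * s k ^+ 2 <= 1 + l k.+1.
  have -> : (s k.+1 * l k.+1 - s k * l k) * s k ^+ 2 =
    (l k.+1 - l k) * s k ^+ 3 + (s k.+1 - s k) * s k ^+ 2 * l k.+1 by ring.
  apply: lerD => //.
  by have := ler_wpM2r (ltW lp') ds; rewrite mul1r.
have main : (1 + l k.+1) * (s k.+1 * l k.+1) <= kappa * eta ^+ 2 * s k ^+ 2.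
  have h1 : (1 + l k.+1) * l k.+1 <= 156 * q ^+ 2 by nra.
  have h2 : 624 <= kappa * eta ^+ 2 * q ^+ 2.
    by move: qB; rewrite /B ler_pdivrMr ?mulr_gt0 ?exprn_gt0 // mulrC.
  have h3 : s k.+1 ^+ 2 <= 4 * s k ^+ 2 by nra.
  have h4 : (1 + l k.+1) * l k.+1 * s k.+1 <= 156 * q ^+ 2 * s k.+1.
    by rewrite ler_pM2r.
  have h5 : 624 * (q ^+ 2 * s k.+1) <= kappa * eta ^+ 2 * q ^+ 2 * (q ^+ 2 * s k.+1).
    by rewrite ler_pM2r // mulr_gt0 // exprn_gt0.
  have e5 : kappa * eta ^+ 2 * q ^+ 2 * (q ^+ 2 * s k.+1)
      = kappa * eta ^+ 2 * s k.+1 ^+ 2 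
      by rewrite [s k.+1 ^+ 2]expr2 {2}sq; ring.
  have h6 : kappa * eta ^+ 2 * s k.+1 ^+ 2 <= kappa * eta ^+ 2 * (4 * s k ^+ 2).
    by rewrite ler_pM2l // mulr_gt0 // exprn_gt0.
  by lra.
rewrite -(ler_pM2r s20).
have h := ler_wpM2r (ltW (sl_gt0 k.+1)) inc.
by lra.
Qed.

(** [eta_k^3 = eta^3 / (k ln^3 k)] is dominated by the telescoping series of
    [1 / ln]. *)
Lemma step_cubes : exists2 S, 0 <= S &
  forall n N, \sum_(n <= k < N) eta_ k.+1 ^+ 3 <= S.
Proof.
exists (4 * eta ^+ 3); first by rewrite mulr_ge0 // exprn_ge0 // ltW.
have e3 : 0 < eta ^+ 3 by rewrite exprn_gt0.
have term k : eta_ k.+1 ^+ 3 <= 2 * eta ^+ 3 * (1 / l k - 1 / l k.+1).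
  rewrite etaE -/(T _) -/(s _) -/(l _) expr_div_n exprMn s3.
  have lp := l_gt0 k; have lp' := l_gt0 k.+1; have tp := T_gt0 k.+1.
  have d : 1 / T k.+1 <= l k.+1 - l k.
    by have := ln_succ_ge (T_gt0 k); rewrite -TS -/(l k) -/(l k.+1); lra.
  have -> : 1 / l k - 1 / l k.+1 = (l k.+1 - l k) / (l k * l k.+1).
    by field; rewrite !gt_eqF.
  have -> : eta ^+ 3 / (T k.+1 * l k.+1 ^+ 3) =
      eta ^+ 3 * (1 / T k.+1 * (1 / l k.+1 ^+ 3)) by field; rewrite !gt_eqF.
  have -> : 2 * eta ^+ 3 * ((l k.+1 - l k) / (l k * l k.+1)) =
      eta ^+ 3 * ((l k.+1 - l k) * (2 / (l k * l k.+1))) by ring.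
  rewrite ler_pM2l //.
  apply: ler_pM => //; try by rewrite divr_ge0 ?exprn_ge0 ?(ltW tp) ?(ltW lp').
  rewrite -[2 / _]invf_div div1r lef_pV2 ?posrE ?divr_gt0 ?mulr_gt0 ?exprn_gt0 //.
  rewrite ler_pdivrMr //.
  have h : l k * l k.+1 <= l k.+1 ^+ 2 by rewrite expr2 ler_pM2r // l_mono.
  have : 1 / 2 * l k.+1 ^+ 2 <= l k.+1 * l k.+1 ^+ 2.
    by rewrite ler_pM2r ?exprn_gt0 // l_ge.
  by rewrite -exprS; lra.
have inv2 k : 1 / l k <= 2 by rewrite ler_pdivrMr //; have := l_ge k; lra.
move=> n N; have [Nn|/ltnW nN] := leqP N n.
  by rewrite big_geq // mulr_ge0 ?ltW.
apply: le_trans (ler_sum_nat _) _; first by move=> k _; exact: term.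
rewrite -mulr_sumr.
have -> : \sum_(n <= k < N) (1 / l k - 1 / l k.+1) = 1 / l n - 1 / l N.
  rewrite -[RHS]opprB -(telescope_sumr (fun k => 1 / l k)) // -sumrN.
  by apply: eq_bigr => k _; rewrite opprB.
have := inv2 n; have : 0 < 1 / l N by rewrite divr_gt0.
by move=> ? ?; nra.
Qed.

(** With [K] of order [(ln (1/eps) / eps)^3], the average [C / (eta_K K)] is of
    order [K^(-2/3) ln K], hence below [eps^2]. *)
Lemma iteration_count (C : R) : 0 <= C -> exists2 M, 0 < M &
  forall eps, 0 < eps <= 1 / 2 -> exists K : nat,
  [/\ (0 < K)%N, K%:R <= M * eps ^- 3 * ln (1 / eps) ^+ 3 &
      C / eta_ K <= eps ^+ 2 * K%:R].
Proof.
move=> C0; pose D1 := 1 + k0; pose C' := C * D1 / eta.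
have D1p : 3 <= D1 by rewrite /D1; have := k0_ge2; lra.
have C'0 : 0 <= C' by rewrite divr_ge0 ?(ltW eta_gt0) // mulr_ge0 //; lra.
(* Chosen so that [C' (2 D1 + 18 + 6 M) <= M^2 / 2], where [2 D1 + 18 + 6 M]
   bounds the logarithm of [K + k0] in units of [ln (1 / eps)]. *)
pose M := 1 + 2 * C' * (2 * D1 + 24).
have D2 : 0 <= 2 * D1 + 24 by clearbody C'; clearbody D1; lra.
have M1 : 1 <= M by rewrite /M lerDl; apply: mulr_ge0 D2; apply: mulr_ge0.
have M0 : 0 < M by lra.
exists (2 * M ^+ 3); first by rewrite mulr_gt0 // exprn_gt0.
move=> eps /andP[e0 e2]; set ll := ln (1 / eps).
have ie : 2 <= 1 / eps by rewrite ler_pdivlMr //; lra.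
have ll2 : 1 / 2 <= ll by exact: ln_ge_half.
have ll0 : 0 < ll by lra.
pose z := M * ll / eps.
have z0 : 0 < z by rewrite divr_gt0 // mulr_gt0.
have z1 : 1 <= z.
  rewrite /z -[_ / eps]mulrA -[ll / eps]mulrC -div1r.
  have : 1 <= 1 / eps * ll by nra.
  by nra.
pose K := (Num.truncn (z ^+ 3)).+1; exists K.
have zK : z ^+ 3 <= K%:R by exact: ltW (truncnS_gt _).
have z31 : 1 <= z ^+ 3 by rewrite exprn_ege1.
have Kz : K%:R <= 2 * z ^+ 3.
  rewrite /K -natr1.
  have : (Num.truncn (z ^+ 3))%:R <= z ^+ 3.
    by rewrite truncn_le // exprn_ge0 // ltW.
  by move: (_%:R) z31 => y; lra.
have K1 : 1 <= K%:R :> R by rewrite ler1n.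
split => //.
  suff -> : 2 * M ^+ 3 * eps ^- 3 * ll ^+ 3 = 2 * z ^+ 3 by [].
  by rewrite /z !exprMn exprVn; ring.
rewrite -[_ / eta_ K]mulr1 -mulrA mulr1 -div1r step_inv.
have lK : l K <= ll * (2 * D1 + 18 + 6 * M).
  have TK : T K <= D1 * (2 * z) ^+ 3.
    apply: (@le_trans _ _ (D1 * K%:R)).
      by rewrite /T mulrDl mul1r lerD2l ler_peMr.
    rewrite ler_pM2l; last by lra.
    by rewrite exprMn; move: (K%:R) Kz z31 => y; lra.
  have zp : 2 * z = 2 * M * ll * (1 / eps) by rewrite /z; ring.
  apply: (@le_trans _ _ (ln (D1 * (2 * z) ^+ 3))).
    by rewrite ler_ln ?posrE // mulr_gt0 ?exprn_gt0 //; nra.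
  have Dp : 0 < D1 by lra.
  have z20 : 0 < 2 * z by rewrite mulr_gt0.
  have ie0 : 0 < 1 / eps by lra.
  have lz : ln (2 * z) = ln 2 + ln M + ln ll + ll.
    have M2 : 0 < 2 * M by rewrite mulr_gt0.
    have Ml : 0 < 2 * M * ll by rewrite mulr_gt0.
    by rewrite zp (lnM Ml ie0) (lnM M2 ll0) lnM ?posrE.
  rewrite lnM ?posrE ?exprn_gt0 // lnXn // lz -[_ *+ 3]mulr_natl.
  have := ln_sublinear Dp; have := ln_sublinear M0; have := ln_sublinear ll0.
  have := @ln_sublinear R 2 ltac:(lra).
  by nra.
pose q := K%:R `^ (3%:R^-1) : R.
have q3 : q ^+ 3 = K%:R by rewrite /q powR_invrn.
have q0 : 0 < q by apply: powR_gt0; rewrite ltr0n.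
have sq : s K <= D1 * q.
  have D10 : 0 <= D1 by move: D1p; clearbody D1; lra.
  rewrite -(@ler_pXn2r _ 3) ?nnegrE ?(mulr_ge0 D10) ?(ltW (s_gt0 _)) ?(ltW q0) //.
  rewrite s3 exprMn q3 /T.
  apply: (@le_trans _ _ (D1 * K%:R)).
    by rewrite mulrDl mul1r lerD2l ler_peMr.
  rewrite ler_pM2r ?ltr0n // -[leLHS]expr1 ler_weXn2l //.
  by move: D1p; clearbody D1; lra.
have zq : z <= q.
  by rewrite -(@ler_pXn2r _ 3) ?nnegrE ?(ltW q0) ?(ltW z0) // q3.
have epsq : M * ll <= eps * q by rewrite [eps * q]mulrC -ler_pdivrMr.
have C'M : C' * (2 * D1 + 18 + 6 * M) <= M * M / 2.
  have : 2 * D1 + 18 + 6 * M <= M * (2 * D1 + 24) by nra.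
  move=> /(ler_wpM2l C'0); have : 2 * C' * (2 * D1 + 24) <= M by rewrite /M; lra.
  by nra.
have -> : eps ^+ 2 * K%:R = q * (eps * q) ^+ 2 by rewrite -q3; ring.
apply: (@le_trans _ _ (C * (D1 * q * (ll * (2 * D1 + 18 + 6 * M)) / eta))).
  rewrite ler_wpM2l // ler_pM2r ?invr_gt0 //.
  by apply: ler_pM => //; exact/ltW.
have -> : C * (D1 * q * (ll * (2 * D1 + 18 + 6 * M)) / eta) =
   q * (ll * (C' * (2 * D1 + 18 + 6 * M))) by rewrite /C'; ring.
rewrite ler_pM2l //.
apply: (@le_trans _ _ ((M * ll) ^+ 2)); last first.
  rewrite ler_pXn2r // nnegrE ltW // mulr_gt0 //.
apply: (@le_trans _ _ (ll * (M * M / 2))); first by rewrite ler_pM2l.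
have -> : (M * ll) ^+ 2 = ll * (M * M * ll) by ring.
by rewrite ler_pM2l // ler_pM2l ?mulr_gt0 //; lra.
Qed.

End step_sizes.

(** * The pathwise descent inequality *)

Section one_step.
Context {R : realType} {p n : nat} (A : 'M[R]_(p, n)).
Variables (L m rho c1 : R).
Hypotheses (m_gt0 : 0 < m) (rho_gt0 : 0 < rho).
Local Notation a2 := (frob_sq A).

Definition augmented_lagrangian (f0 : R) (l r : 'cV[R]_p) : R :=
  f0 + dotv l r + rho / 2 * nsq r.

(** The primal step is a gradient step on the augmented Lagrangian with error
    [e]; the dual step then raises the value by [rho |r1|^2]. *)
Lemma lagrangian_descent (h f0 f1 : R) (gr e v : 'cV[R]_n) (l r : 'cV[R]_p)
    (r1 := r + h *: (A *m v)) :
  0 < h -> v = - (gr + e + A^T *m l + rho *: (A^T *m r)) ->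
  f1 <= f0 + h * dotv gr v + L * h ^+ 2 * nsq v ->
  augmented_lagrangian f1 (l + rho *: r1) r1 <= augmented_lagrangian f0 l r + rho * nsq r1
    - h / 2 * nsq v + h / 2 * nsq e + (L + rho * a2) * h ^+ 2 * nsq v.
Proof.
move=> h0 vE df.
have vv : nsq v = - (dotv gr v + dotv e v + dotv l (A *m v) + rho * dotv r (A *m v)).
  rewrite {1}/nsq {1}vE dotvNl !dotvDl dotvZl.
  by rewrite !(dotvC (A^T *m _)) -!dotv_mulmx !(dotvC (A *m v)).
have ev := nsq_ge0 (e + v).
have ev' : 0 <= h * nsq (e + v) by rewrite mulr_ge0 // ltW.
have ye : 0 <= rho * h ^+ 2 * (a2 * nsq v - nsq (A *m v)).
  by rewrite mulr_ge0 ?subr_ge0 ?nsq_mulmx // mulr_ge0 ?sqr_ge0 // ltW.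
have y0 : 0 <= rho * h ^+ 2 * nsq (A *m v).
  by rewrite mulr_ge0 ?nsq_ge0 // mulr_ge0 ?sqr_ge0 // ltW.
have vv' := congr1 (fun z => h * z) vv; cbv beta in vv'.
rewrite /augmented_lagrangian {}/r1; move: ev' ye y0 vv' df.
rewrite /nsq !dotvE (dotvC v e) !(dotvC (A *m v)).
set t1 := dotv (A *m v) _; lra.
Qed.

(** The residual lies in the range of [A], where [spectral_gap] bounds [A^T]
    from below; the hypothesis on [rho] turns that bound into this constant. *)
Lemma residual_le_dual (delta : R) (x : 'cV[R]_n) (r1 := A *m x) :
  smallest_nonzero_eigenvalue (A^T *m A) delta ->
  7 * (1 + c1) <= rho * m * delta ->
  (1 + c1) * rho * nsq r1 <= m / 7 * nsq (rho *: (A^T *m r1)).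
Proof.
move=> sd hm; have [d0 gap] := spectral_gap x sd; rewrite nsqZ.
have : 0 <= m * rho ^+ 2 * (nsq (A^T *m r1) - delta * nsq r1).
  by rewrite mulr_ge0 ?subr_ge0 // mulr_ge0 ?sqr_ge0 // ltW.
have : 0 <= (rho * m * delta - 7 * (1 + c1)) * (rho * nsq r1).
  by rewrite mulr_ge0 ?subr_ge0 // mulr_ge0 ?nsq_ge0 // ltW.
lra.
Qed.

Section dual_increment.
Variables (h h' : R) (g g' v v' : 'cV[R]_n) (l r l' r' : 'cV[R]_p).
Let r1 := r + h *: (A *m v).
Let q := rho *: (A^T *m r1).
Let dd := A *m (h *: v - h' *: v').
Hypotheses (h_gt0 : 0 < h).
Hypotheses (vE : v = - (g + A^T *m l + rho *: (A^T *m r)))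
  (v'E : v' = - (g' + A^T *m l' + rho *: (A^T *m r')))
  (lE : l = l' + rho *: r) (rE : r = r' + h' *: (A *m v')).

(** The difference of two consecutive primal updates, with [A^T l] eliminated. *)
Lemma dual_incrementE :
  q = - (v - v') - (g - g') + rho *: (A^T *m dd).
Proof.
have e1 : A^T *m l = - v - g - rho *: (A^T *m r).
  by rewrite vE opprK; apply/matrixP => i j; rewrite !mxE; ring.
have e2 : A^T *m l' = - v' - g' - rho *: (A^T *m r').
  by rewrite v'E opprK; apply/matrixP => i j; rewrite !mxE; ring.
have e3 : A^T *m l = A^T *m l' + rho *: (A^T *m r).
  by rewrite {1}lE mulmxDr -scalemxAr.
have e4 : A^T *m r = A^T *m r' + h' *: (A^T *m (A *m v')).
  by rewrite {1}rE mulmxDr -scalemxAr.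
have e5 : A^T *m r1 = A^T *m r + h *: (A^T *m (A *m v)).
  by rewrite mulmxDr -scalemxAr.
have e6 : A^T *m dd = h *: (A^T *m (A *m v)) - h' *: (A^T *m (A *m v')).
  by rewrite /dd !mulmxBr -!scalemxAr.
apply/matrixP => i j.
move: e1 e2 e3 e4 e5 e6 => /matrixP /(_ i j) e1 /matrixP /(_ i j) e2
  /matrixP /(_ i j) e3 /matrixP /(_ i j) e4 /matrixP /(_ i j) e5
  /matrixP /(_ i j) e6.
move: e1 e2 e3 e4 e5 e6; rewrite /q.
move: (A^T *m l) (A^T *m l') (A^T *m r) (A^T *m r') (A^T *m r1) (A^T *m dd)
  (A^T *m (A *m v)) (A^T *m (A *m v')) => a1 a3 a4 a5 a6 a7 a8 a9.
rewrite !mxE => e1 e2 e3 e4 e5 e6.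
rewrite e5 e6; move: e3; rewrite e1 e2 e4; lra.
Qed.

(** The inner product of the dual increment with [v] yields the decrease in
    [|v - v'|^2] that pays for the increase of the Lagrangian. *)
Lemma dual_increment_dot :
  rho / (2 * h) * (nsq r1 - nsq r)
    + 1 / 2 * (nsq v - nsq v' + nsq (v - v'))
  <= - dotv (g - g') v + rho / (2 * h) * nsq dd.
Proof.
have qv : dotv q v = rho * dotv r1 (A *m v).
  by rewrite dotvZl dotvC -dotv_mulmx dotvC.
have rE1 : nsq r = nsq r1 - 2 * h * dotv r1 (A *m v) + h ^+ 2 * nsq (A *m v).
  have {1}-> : r = r1 - h *: (A *m v) by rewrite addrK.
  by rewrite /nsq !dotvE !(dotvC (A *m v)); ring.
have ddE : nsq dd = h ^+ 2 * nsq (A *m v)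
    - 2 * h * h' * dotv (A *m v) (A *m v') + h' ^+ 2 * nsq (A *m v').
  rewrite /dd mulmxBr -!scalemxAr /nsq !dotvE (dotvC (A *m v')); ring.
have qv2 : dotv q v = - nsq v + dotv v v' - dotv (g - g') v
    + rho * (h * nsq (A *m v) - h' * dotv (A *m v) (A *m v')).
  have ddv : dotv (A^T *m dd) v
      = h * nsq (A *m v) - h' * dotv (A *m v) (A *m v').
    rewrite dotvC -dotv_mulmx /dd mulmxBr -!scalemxAr /nsq !dotvE; ring.
  rewrite dual_incrementE -ddv /nsq !dotvE (dotvC v' v); ring.
have w' : 0 <= rho / (2 * h) * (h' ^+ 2 * nsq (A *m v')).
  apply: mulr_ge0; last by rewrite mulr_ge0 ?sqr_ge0 ?nsq_ge0.
  by apply: divr_ge0; [exact: ltW|rewrite mulr_ge0 // ltW].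
have hV : rho / (2 * h) * (2 * h) = rho by field; rewrite gt_eqF.
have pE : nsq (v - v') = nsq v - 2 * dotv v v' + nsq v'.
  by rewrite /nsq !dotvE (dotvC v' v); ring.
rewrite ddE rE1 pE; move: qv2 w'; rewrite qv.
set s := rho / (2 * h) in hV *; rewrite -hV => qv2 w'.
nra.
Qed.

Lemma dual_increment_le :
  nsq q <= 3 * nsq (v - v') + 3 * nsq (g - g') + 3 * (rho ^+ 2 * a2 * nsq dd).
Proof.
rewrite dual_incrementE; apply: le_trans (nsqD3 _ _ _) _.
rewrite !nsqN nsqZ lerD2l ler_pM2l // -mulrA ler_wpM2l ?sqr_ge0 //.
exact: nsq_mulmx_tr.
Qed.

Lemma displacement_le tau : h' - h = h * h' * tau ->
  nsq dd <= 2 * a2 * h ^+ 2 * nsq (v - v')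
    + 2 * a2 * (h * h' * tau) ^+ 2 * nsq v'.
Proof.
move=> tE; apply: le_trans (nsq_mulmx _ _) _.
have -> : h *: v - h' *: v' = h *: (v - v') + (- (h * h' * tau)) *: v'.
  by rewrite -tE scalerBr scaleNr scalerBl opprB addrA subrK.
have := nsqD (h *: (v - v')) (- (h * h' * tau) *: v').
rewrite !nsqZ sqrrN => /(ler_wpM2l (frob_ge0 A)); lra.
Qed.

End dual_increment.

(** The ascent [rho |r1|^2] is at most [m/7 |q|^2], hence at most
    [3 m / 7 |v - v'|^2] up to lower order terms, which is less than the
    decrease [m/2 |v - v'|^2] of [dual_increment_dot]. *)
Lemma pathwise_descent (delta h h' h2 tau f0 f1 : R) (x1 : 'cV[R]_n)
    (gr e g g' v v' : 'cV[R]_n) (l r l' r' r1 : 'cV[R]_p) :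
  smallest_nonzero_eigenvalue (A^T *m A) delta ->
  7 * (1 + c1) <= rho * m * delta ->
  0 < h -> 0 < h' -> h' - h = h * h' * tau ->
  rho * a2 * h <= 1 / 28 -> (L + rho * a2) * h <= 1 / 16 ->
  m * h' * tau ^+ 2 <= 1 / 4 -> m * (1 / h2 - 1 / h) <= c1 ->
  v = - (g + A^T *m l + rho *: (A^T *m r)) -> g = gr + e ->
  v' = - (g' + A^T *m l' + rho *: (A^T *m r')) ->
  l = l' + rho *: r -> r = r' + h' *: (A *m v') -> r1 = r + h *: (A *m v) ->
  r1 = A *m x1 ->
  f1 <= f0 + h * dotv gr v + L * h ^+ 2 * nsq v ->
  augmented_lagrangian f1 (l + rho *: r1) r1 + m * rho / 2 * (1 / h2) * nsq r1
    + m / 2 * nsq v + c1 * rho / 2 * nsq r1 + 3 / 8 * h * nsq v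
  <= augmented_lagrangian f0 l r + m * rho / 2 * (1 / h) * nsq r + m / 2 * nsq v'
    + h / 2 * nsq e + (4 * m ^+ 2 / h + m) * nsq (g - g') + h' / 32 * nsq v'.
Proof.
move=> sd hm h0 h'0 tE sm1 sm2 sm3 sm4 vE gE v'E lE rE r1E r1A df.
have vE' := vE; rewrite gE in vE'.
have LD := lagrangian_descent h0 vE' df; rewrite -r1E in LD.
have RD := residual_le_dual x1 sd hm; rewrite -r1A in RD.
have DI := dual_increment_le h vE v'E lE rE; rewrite -r1E in DI.
have DD := dual_increment_dot h0 vE v'E lE rE; rewrite -r1E in DD.
have DS := displacement_le v v' tE.
have ih : 0 < 1 / h by rewrite divr_gt0.
have hV : h * (1 / h) = 1 by rewrite div1r mulfV // gt_eqF.
have {}hV : rho / (2 * h) = rho / 2 * (1 / h) by field; rewrite gt_eqF.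
have hI : h * (1 / h) = 1 by rewrite div1r mulfV // gt_eqF.
have {}DD := ler_wpM2l (ltW m_gt0) DD; rewrite hV in DD.
(* The cross term [m <g - g', v>] is split by completing a square. *)
have YG : 0 <= h / 16 * nsq v + m * dotv (g - g') v + 4 * m ^+ 2 / h * nsq (g - g').
  have -> : h / 16 * nsq v + m * dotv (g - g') v + 4 * m ^+ 2 / h * nsq (g - g')
      = 1 / h * nsq (h / 4 *: v + 2 * m *: (g - g')).
    move: (g - g') => dg; rewrite /nsq !dotvE (dotvC v dg).
    by field; rewrite gt_eqF.
  by rewrite mulr_ge0 ?nsq_ge0 // ltW.
have LS : (L + rho * a2) * h ^+ 2 * nsq v <= h / 16 * nsq v.
  rewrite ler_wpM2r ?nsq_ge0 //; have := ler_wpM2r (ltW h0) sm2; lra.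
have RR : m * rho / 2 * (1 / h2) * nsq r1
    <= m * rho / 2 * (1 / h) * nsq r1 + c1 * rho / 2 * nsq r1.
  have : 0 <= rho / 2 * nsq r1 by rewrite mulr_ge0 ?nsq_ge0 // divr_ge0 // ltW.
  by move=> /(ler_wpM2r)/(_ _ _ sm4); lra.
(* The displacement terms carry a factor [z] or [z^2]; with [z <= 1/28] the total
   coefficient of [|v - v'|^2] is at most [3/7 + 1/28 + 1/500 < 1/2]. *)
pose z := rho * a2 * h.
have z0 : 0 <= z := mulr_ge0 (mulr_ge0 (ltW rho_gt0) (frob_ge0 A)) (ltW h0).
pose T2 := (h' * tau) ^+ 2; pose Y := nsq (v - v') + T2 * nsq v'.
have Y0 : 0 <= Y.
  by apply: addr_ge0; [exact: nsq_ge0|rewrite mulr_ge0 ?nsq_ge0 // sqr_ge0].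
have TV : m * T2 * nsq v' <= h' / 4 * nsq v'.
  rewrite ler_wpM2r ?nsq_ge0 //; have := ler_wpM2r (ltW h'0) sm3.
  by rewrite /T2; lra.
set X := nsq (A *m _) in DI DD DS.
have {}DS : X <= 2 * a2 * h ^+ 2 * Y by move: DS; rewrite /Y /T2; lra.
have B1 : m * (rho / 2 * (1 / h) * X) <= m / 28 * Y.
  have c0 : 0 <= m * (rho / 2 * (1 / h)).
    apply: mulr_ge0 (ltW m_gt0) (mulr_ge0 _ (ltW ih)).
    by rewrite divr_ge0 // ltW.
  have : m * (rho / 2 * (1 / h)) * X <= m * z * Y.
    have -> : m * z * Y = m * (rho / 2 * (1 / h)) * (2 * a2 * h ^+ 2 * Y).
      by rewrite /z; field; rewrite gt_eqF.
    exact: ler_wpM2l.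
  have : m * z * Y <= m * (1 / 28) * Y.
    by rewrite ler_wpM2r // ler_wpM2l // ltW.
  by lra.
have B2 : m / 7 * (3 * (rho ^+ 2 * a2 * X)) <= m / 500 * Y.
  have c0 : 0 <= m / 7 * 3 * (rho ^+ 2 * a2).
    apply: mulr_ge0; last by rewrite mulr_ge0 ?sqr_ge0 ?frob_ge0.
    by rewrite mulr_ge0 // divr_ge0 // ltW.
  have := ler_wpM2l c0 DS.
  have zz : z ^+ 2 <= 1 / 784.
    have -> : 1 / 784 = (1 / 28) ^+ 2 :> R by field.
    by rewrite ler_pXn2r // nnegrE; lra.
  have : m * z ^+ 2 * Y <= m * (1 / 784) * Y.
    by rewrite ler_wpM2r // ler_wpM2l // ltW.
  have : m / 7 * 3 * (rho ^+ 2 * a2) * (2 * a2 * h ^+ 2 * Y) = 6 / 7 * (m * z ^+ 2 * Y).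
    by rewrite /z; field.
  have : 0 <= m * Y by rewrite mulr_ge0 // ltW.
  by lra.
have DI' := ler_wpM2l (_ : 0 <= m / 7) DI.
have {}DI' : m / 7 * nsq (rho *: (A^T *m r1)) <= m / 7 * 3 * nsq (v - v')
    + m / 7 * 3 * nsq (g - g') + m / 500 * Y.
  have m7 : 0 <= m / 7 by rewrite divr_ge0 // ltW.
  have := DI' m7; lra.
have YE : m * Y <= m * nsq (v - v') + h' / 4 * nsq v' by rewrite /Y; lra.
have mP : 0 <= m * nsq (v - v') by rewrite mulr_ge0 ?nsq_ge0 // ltW.
have mG : 0 <= m * nsq (g - g') by rewrite mulr_ge0 ?nsq_ge0 // ltW.
have hV0 : 0 <= h' * nsq v' by rewrite mulr_ge0 ?nsq_ge0 // ltW.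
move: LD RD DD YG LS RR B1 DI' YE mP mG hV0 {TV DS DI}.
set T := 4 * m ^+ 2 / h * nsq (g - g').
have -> : (4 * m ^+ 2 / h + m) * nsq (g - g') = T + m * nsq (g - g').
  by rewrite mulrDl.
move: T => T; lra.
Qed.

End one_step.

(** * Expectations and square-integrable vectors *)

Section expectation.
Context {R : realType} {dT : measure_display} {T : measurableType dT}.
Variable P : probability T R.
Implicit Types X Y : T -> R.

Definition summable_rv X := P.-integrable setT (EFin \o X).

Definition Ex X : R := \int[P]_w X w.

Lemma summable_measurable X : summable_rv X -> measurable_fun setT X.
Proof. by move=> /integrableP[/measurable_EFinP]. Qed.

Lemma summableD X Y : summable_rv X -> summable_rv Y ->
  summable_rv (fun w => X w + Y w).
Proof. by move=> iX iY; have := integrableD measurableT iX iY. Qed.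

Lemma summableZ a X : summable_rv X -> summable_rv (fun w => a * X w).
Proof. by move=> iX; have := integrableZl measurableT a iX. Qed.

Lemma summable_cst a : summable_rv (fun _ => a).
Proof. exact: finite_measure_integrable_cst. Qed.

Lemma summable_le X Y : measurable_fun setT X -> (forall w, `|X w| <= Y w) ->
  summable_rv Y -> summable_rv X.
Proof.
move=> mX XY; apply: le_integrable => //; first exact/measurable_EFinP.
by move=> w _; rewrite /= lee_fin (le_trans (XY w)) // ler_norm.
Qed.

Lemma summable_ge0_le X Y : measurable_fun setT X ->
  (forall w, 0 <= X w <= Y w) -> summable_rv Y -> summable_rv X.
Proof.
move=> mX XY; apply: summable_le => // w; have /andP[X0 XYw] := XY w.
by rewrite ger0_norm.
Qed.

Lemma summable_sum (I : Type) (s : seq I) (X : I -> T -> R) :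
  (forall i, summable_rv (X i)) -> summable_rv (fun w => \sum_(i <- s) X i w).
Proof.
move=> iX; elim: s => [|i s IH].
  by under eq_fun do rewrite big_nil; exact: summable_cst.
by under eq_fun do rewrite big_cons; exact: summableD.
Qed.

Lemma ExD X Y : summable_rv X -> summable_rv Y ->
  Ex (fun w => X w + Y w) = Ex X + Ex Y.
Proof. exact: RintegralD. Qed.

Lemma ExZ a X : summable_rv X -> Ex (fun w => a * X w) = a * Ex X.
Proof. exact: RintegralZl. Qed.

Lemma Ex_cst a : Ex (fun _ => a) = a.
Proof.
rewrite /Ex Rintegral_cst // -[RHS]mulr1; congr (_ * _).
have p1 : P setT = 1%E by exact: probability_setT.
exact: (congr1 (@fine R) p1).
Qed.

Lemma Ex_le X Y : summable_rv X -> summable_rv Y ->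
  (forall w, X w <= Y w) -> Ex X <= Ex Y.
Proof. by move=> iX iY XY; apply: le_Rintegral. Qed.

Lemma Ex_ge0 X : (forall w, 0 <= X w) -> 0 <= Ex X.
Proof. by move=> X0; apply: Rintegral_ge0. Qed.

Lemma EFin_Ex X : summable_rv X -> ((Ex X)%:E = \int[P]_w (X w)%:E)%E.
Proof. by move=> iX; rewrite /Ex /Rintegral fineK //; exact: integrable_fin_num. Qed.

Lemma Ex_sum (I : Type) (s : seq I) (X : I -> T -> R) :
  (forall i, summable_rv (X i)) ->
  Ex (fun w => \sum_(i <- s) X i w) = \sum_(i <- s) Ex (X i).
Proof.
move=> iX; elim: s => [|i s IH].
  by under eq_fun do rewrite big_nil; rewrite Ex_cst big_nil.
under eq_fun do rewrite big_cons.
by rewrite ExD ?IH ?big_cons //; exact: summable_sum.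
Qed.

Lemma summable_bound X M : measurable_fun setT X -> (forall w, 0 <= X w) ->
  (\int[P]_w (X w)%:E <= M%:E)%E -> summable_rv X /\ Ex X <= M.
Proof.
move=> mX X0 XM.
have iX : summable_rv X.
  apply/integrableP; split; first exact/measurable_EFinP.
  apply: le_lt_trans (ltry M); apply: le_trans XM.
  by under eq_integral => w _ do rewrite /= ger0_norm //.
by split=> //; rewrite -lee_fin EFin_Ex.
Qed.

(** Linear combinations are given as an initial term and a list of weighted
    terms, so that an inequality with many terms is integrated in one step: both
    sides compute to the expected left-associated sums. *)
Lemma Ex_le_comb X Y (s t : seq (R * (T -> R))) :
  summable_rv X -> summable_rv Y ->
  (forall z, List.In z (s ++ t) -> summable_rv z.2) ->
  (forall w, foldl (fun a z => a + z.1 * z.2 w) (X w) s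
    <= foldl (fun a z => a + z.1 * z.2 w) (Y w) t) ->
  foldl (fun a z => a + z.1 * Ex z.2) (Ex X) s
    <= foldl (fun a z => a + z.1 * Ex z.2) (Ex Y) t.
Proof.
have lin (u : seq (R * (T -> R))) (Z : T -> R) : summable_rv Z ->
    (forall z, List.In z u -> summable_rv z.2) ->
    summable_rv (fun w => foldl (fun a z => a + z.1 * z.2 w) (Z w) u) /\
    Ex (fun w => foldl (fun a z => a + z.1 * z.2 w) (Z w) u)
      = foldl (fun a z => a + z.1 * Ex z.2) (Ex Z) u.
  elim: u Z => [//|z u IH] Z iZ iu.
  have iz := iu z (or_introl erefl).
  have iZz : summable_rv (fun w => Z w + z.1 * z.2 w).
    by apply: summableD => //; exact: summableZ.
  have [i1 i2] := IH _ iZz (fun z zu => iu z (or_intror zu)).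
  split; first exact: i1.
  by rewrite /= -[X in foldl _ (X + _)]/(Ex Z) -ExZ // -ExD //; exact: summableZ.
move=> iX iY ist le_st.
have [is1 is2] := lin s X iX (fun z h => ist z (List.in_or_app _ _ _ (or_introl h))).
have [it1 it2] := lin t Y iY (fun z h => ist z (List.in_or_app _ _ _ (or_intror h))).
by rewrite -is2 -it2; exact: Ex_le.
Qed.

Definition vmeas n (X : T -> 'cV[R]_n) :=
  forall i, measurable_fun setT (fun w => X w i ord0).

Definition L2v n (X : T -> 'cV[R]_n) :=
  vmeas X /\ summable_rv (fun w => nsq (X w)).

End expectation.

Section random_vectors.
Context {R : realType} {dT : measure_display} {T : measurableType dT}.

Lemma vmeasD n (X Y : T -> 'cV[R]_n) : vmeas X -> vmeas Y ->
  vmeas (fun w => X w + Y w).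
Proof.
by move=> mX mY i; under eq_fun do rewrite mxE; exact: measurable_funD.
Qed.

Lemma vmeasZ n a (X : T -> 'cV[R]_n) : vmeas X -> vmeas (fun w => a *: X w).
Proof.
move=> mX i; under eq_fun do rewrite mxE; exact: measurable_funM.
Qed.

Lemma vmeasN n (X : T -> 'cV[R]_n) : vmeas X -> vmeas (fun w => - X w).
Proof.
by move=> mX; under eq_fun do rewrite -scaleN1r; exact: vmeasZ.
Qed.

Lemma vmeas_cst n (c : 'cV[R]_n) : vmeas (fun _ : T => c).
Proof. by move=> i; exact: measurable_cst. Qed.

Lemma vmeas_mulmx p n (A : 'M[R]_(p, n)) (X : T -> 'cV[R]_n) :
  vmeas X -> vmeas (fun w => A *m X w).
Proof.
move=> mX i; under eq_fun do rewrite mxE.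
apply: measurable_sum => j; exact: measurable_funM.
Qed.

Lemma vmeas_comp d1 (T1 : measurableType d1) n (X : T -> 'cV[R]_n) (u : T1 -> T) :
  measurable_fun setT u -> vmeas X -> vmeas (fun w => X (u w)).
Proof. by move=> mu mX i; exact: measurableT_comp (mX i) mu. Qed.

Lemma measurable_dotv n (X Y : T -> 'cV[R]_n) : vmeas X -> vmeas Y ->
  measurable_fun setT (fun w => dotv (X w) (Y w)).
Proof.
by move=> mX mY; apply: measurable_sum => i; exact: measurable_funM.
Qed.

Lemma measurable_nsq n (X : T -> 'cV[R]_n) : vmeas X ->
  measurable_fun setT (fun w => nsq (X w)).
Proof. by move=> mX; exact: measurable_dotv. Qed.

Lemma vmeas_borel n (X : T -> 'cV[R]_n) :
  measurable_fun setT (X : T -> borel_cV R n) -> vmeas X.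
Proof. by move=> mX i; exact: measurableT_comp (@measurable_coord R n i) mX. Qed.

Lemma measurable_continuous_comp n (h : 'cV[R]_n -> R) (X : T -> 'cV[R]_n) :
  continuous h -> vmeas X -> measurable_fun setT (fun w => h (X w)).
Proof.
move=> ch mX.
exact: measurableT_comp (continuous_measurable_borel_cV ch) (measurable_cV mX).
Qed.

Variable P : probability T R.

Lemma L2v_dom n (X : T -> 'cV[R]_n) (Y : T -> R) : vmeas X ->
  (forall w, nsq (X w) <= Y w) -> summable_rv P Y -> L2v P X.
Proof.
move=> mX XY iY; split=> //; apply: summable_ge0_le iY; first exact: measurable_nsq.
by move=> w; rewrite nsq_ge0 XY.
Qed.

Lemma L2vD n (X Y : T -> 'cV[R]_n) : L2v P X -> L2v P Y ->
  L2v P (fun w => X w + Y w).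
Proof.
move=> [mX iX] [mY iY].
apply: (L2v_dom (vmeasD mX mY) (fun w => nsqD (X w) (Y w))).
by apply: summableD; exact: summableZ.
Qed.

Lemma L2vZ n a (X : T -> 'cV[R]_n) : L2v P X -> L2v P (fun w => a *: X w).
Proof.
move=> [mX iX]; split; first exact: vmeasZ.
by under eq_fun do rewrite nsqZ; exact: summableZ.
Qed.

Lemma L2vN n (X : T -> 'cV[R]_n) : L2v P X -> L2v P (fun w => - X w).
Proof. by move=> iX; under eq_fun do rewrite -scaleN1r; exact: L2vZ. Qed.

Lemma L2vB n (X Y : T -> 'cV[R]_n) : L2v P X -> L2v P Y ->
  L2v P (fun w => X w - Y w).
Proof. by move=> iX iY; apply: L2vD => //; exact: L2vN. Qed.

Lemma L2v_cst n (c : 'cV[R]_n) : L2v P (fun _ => c).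
Proof. by split; [exact: vmeas_cst|exact: summable_cst]. Qed.

Lemma L2v_dot n (X Y : T -> 'cV[R]_n) : L2v P X -> L2v P Y ->
  summable_rv P (fun w => dotv (X w) (Y w)).
Proof.
move=> [mX iX] [mY iY]; apply: (@summable_le _ _ _ _ _ (fun w => nsq (X w) + nsq (Y w))).
- exact: measurable_dotv.
- move=> w; rewrite ler_norml; apply/andP.
  have := dotv_young 1 (X w) (Y w); have := dotv_young (- 1) (X w) (Y w).
  have := nsq_ge0 (X w); have := nsq_ge0 (Y w).
  by move=> *; split; lra.
- exact: summableD.
Qed.

Lemma L2v_coord n (X : T -> 'cV[R]_n) i : L2v P X ->
  summable_rv P (fun w => X w i ord0).
Proof.
move=> /L2v_dot /(_ (L2v_cst (delta_mx i ord0))).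
congr summable_rv; apply/funext => w.
rewrite /dotv (bigD1 i) //= big1 ?addr0 ?mxE ?eqxx ?mulr1 // => j ji.
by rewrite mxE (negbTE ji) mulr0.
Qed.

(** The cross term vanishes for a centred vector. *)
Lemma Ex_nsq_centered n (c : 'cV[R]_n) (Z : T -> 'cV[R]_n) : L2v P Z ->
  (forall i, Ex P (fun w => Z w i ord0) = 0) ->
  Ex P (fun w => nsq (c + Z w)) = nsq c + Ex P (fun w => nsq (Z w)).
Proof.
move=> iZ Z0.
have E w : nsq (c + Z w) = (nsq c + 2 * dotv c (Z w)) + nsq (Z w).
  by rewrite /nsq !dotvE (dotvC (Z w) c); ring.
under [in LHS]eq_fun do rewrite E.
have icz : summable_rv P (fun w => dotv c (Z w)) by apply: L2v_dot => //; exact: L2v_cst.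
have i1 : summable_rv P (fun w => nsq c + 2 * dotv c (Z w)).
  by apply: summableD; [exact: summable_cst|exact: summableZ].
rewrite ExD //; last by case: iZ.
rewrite ExD //; [|exact: summable_cst|exact: summableZ].
rewrite Ex_cst ExZ //.
suff -> : Ex P (fun w => dotv c (Z w)) = 0 by rewrite mulr0 addr0.
rewrite /dotv Ex_sum => [|i]; last exact/summableZ/L2v_coord.
by rewrite big1 // => i _; rewrite ExZ ?Z0 ?mulr0 //; exact: L2v_coord.
Qed.

(** [Z] is its mean plus a centred vector, so that the second moment bounds both
    the square of the mean and the centred second moment. *)
Lemma Ex_nsq_center n (mu : 'cV[R]_n) (Z : T -> 'cV[R]_n) : L2v P Z ->
  (forall i, Ex P (fun w => Z w i ord0) = mu i ord0) ->
  Ex P (fun w => nsq (Z w)) = nsq mu + Ex P (fun w => nsq (Z w - mu)).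
Proof.
move=> iZ Zmu.
rewrite -Ex_nsq_centered.
- by congr Ex; apply/funext => w; rewrite addrC subrK.
- by apply: L2vB => //; exact: L2v_cst.
- move=> i; under eq_fun do rewrite !mxE.
  by rewrite ExD ?Ex_cst ?Zmu ?subrr //; [exact: L2v_coord|exact: summable_cst].
Qed.

End random_vectors.

(** * The stochastic gradient oracle *)

Section oracle.
Context {R : realType} {n : nat} {dXi : measure_display} {Xi : measurableType dXi}.
Variables (PXi : probability Xi R) (f : 'cV[R]_n -> R) (G : 'cV[R]_n -> Xi -> 'cV[R]_n).
Variables (L V : R).
Hypothesis G_meas : jointly_measurable G.
Hypothesis G_int : forall x i, PXi.-integrable setT (fun xi => (G x xi i ord0)%:E).
Hypothesis G_mean : forall x i,
  ('E_PXi[fun xi => G x xi i ord0] = (gradient f x i ord0)%:E)%E.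
Hypothesis G_lip : forall u v,
  ('E_PXi[fun xi => (enorm (G u xi - G v xi) ^+ 2)%R]
     <= (L ^+ 2 * enorm (u - v) ^+ 2)%R%:E)%E.
Hypothesis G_var : forall x,
  ('E_PXi[fun xi => (enorm (G x xi - gradient f x) ^+ 2)%R] <= (V ^+ 2)%R%:E)%E.

Lemma vmeas_oracle_comp d (T : measurableType d) (X : T -> 'cV[R]_n) (y : T -> Xi) :
  vmeas X -> measurable_fun setT y -> vmeas (fun t => G (X t) (y t)).
Proof.
move=> mX my; apply: vmeas_borel.
exact: measurableT_comp G_meas (measurable_fun_pair (measurable_cV mX) my).
Qed.

Lemma vmeas_oracle x : vmeas (G x).
Proof.
by apply: (vmeas_oracle_comp (X := fun _ => x) (y := id)) => //; exact: vmeas_cst.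
Qed.

Lemma Ex_oracle x i : Ex PXi (fun xi => G x xi i ord0) = gradient f x i ord0.
Proof. by have := G_mean x i; rewrite unlock /Ex /Rintegral => ->. Qed.

Lemma oracle_diff u v : L2v PXi (fun xi => G u xi - G v xi) /\
  Ex PXi (fun xi => nsq (G u xi - G v xi)) <= L ^+ 2 * nsq (u - v).
Proof.
have mD : vmeas (fun xi => G u xi - G v xi).
  by apply: vmeasD; [|apply: vmeasN]; exact: vmeas_oracle.
have := G_lip u v; rewrite unlock sqr_enorm.
under eq_integral do rewrite sqr_enorm.
by move=> /(summable_bound (measurable_nsq mD))[|iD ?] // w; exact: nsq_ge0.
Qed.

Lemma oracle_noise x : L2v PXi (fun xi => G x xi - gradient f x) /\
  Ex PXi (fun xi => nsq (G x xi - gradient f x)) <= V ^+ 2.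
Proof.
have mD : vmeas (fun xi => G x xi - gradient f x).
  by apply: vmeasD; [exact: vmeas_oracle|exact: vmeas_cst].
have := G_var x; rewrite unlock.
under eq_integral do rewrite sqr_enorm.
by move=> /(summable_bound (measurable_nsq mD))[|iD ?] // w; exact: nsq_ge0.
Qed.

Lemma Ex_oracle_diff u v i :
  Ex PXi (fun xi => (G u xi - G v xi) i ord0) = (gradient f u - gradient f v) i ord0.
Proof.
rewrite coordB; under eq_fun do rewrite coordB -mulN1r.
have iG x : summable_rv PXi (fun xi => G x xi i ord0) by exact: G_int.
by rewrite ExD ?ExZ ?Ex_oracle ?mulN1r //; exact: summableZ.
Qed.

(** By Jensen's inequality the gradient inherits the Lipschitz constant of its
    stochastic oracle. *)
Lemma gradient_lipschitz u v :
  nsq (gradient f u - gradient f v) <= L ^+ 2 * nsq (u - v).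
Proof.
have [iD bD] := oracle_diff u v; apply: le_trans bD.
rewrite (Ex_nsq_center iD (Ex_oracle_diff u v)) lerDl.
by apply: Ex_ge0 => w; exact: nsq_ge0.
Qed.

Lemma gradient_continuous i : continuous (fun x => gradient f x i ord0).
Proof.
apply: (@lipschitz_continuous _ _ _ (L ^+ 2)) => u v.
apply: le_trans (gradient_lipschitz u v).
by have := sqr_coord_le (gradient f u - gradient f v) i; rewrite coordB.
Qed.

Section one_sample.
Variables (x x1 g : 'cV[R]_n) (a : R).
Hypothesis a01 : 0 <= a <= 1.

Let U z xi := G z xi - gradient f z.
Let g1 xi := G x1 xi + (1 - a) *: (g - G x xi).

Let ExU z i : Ex PXi (fun xi => U z xi i ord0) = 0.
Proof.
have iG : summable_rv PXi (fun xi => G z xi i ord0) by exact: G_int.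
rewrite /U; under eq_fun do rewrite coordB.
by rewrite ExD ?Ex_cst ?Ex_oracle ?subrr //; exact: summable_cst.
Qed.

(** The recursive momentum correction: the new error is a contraction of the
    old one plus centred noise proportional to [|x1 - x|] and to [a]. *)
Lemma momentum_error :
  (\int[PXi]_xi (nsq (g1 xi - gradient f x1))%:E <=
    ((1 - a) ^+ 2 * nsq (g - gradient f x) + 2 * L ^+ 2 * nsq (x1 - x)
      + 2 * a ^+ 2 * V ^+ 2)%:E)%E.
Proof.
have [a0 a1] := andP a01.
have [iD bD] := oracle_diff x1 x; have [iU bU] := oracle_noise x1.
pose N xi := (G x1 xi - G x xi) - (gradient f x1 - gradient f x).
have iN : L2v PXi N := L2vB iD (L2v_cst _ _).
have bN : Ex PXi (fun xi => nsq (N xi)) <= L ^+ 2 * nsq (x1 - x).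
  apply: le_trans bD; rewrite (Ex_nsq_center iD (Ex_oracle_diff x1 x)).
  by rewrite lerDr nsq_ge0.
pose Z xi := (1 - a) *: N xi + a *: U x1 xi.
have iZ : L2v PXi Z by apply: L2vD; exact: L2vZ.
have Z0 i : Ex PXi (fun xi => Z xi i ord0) = 0.
  have -> : (fun xi => Z xi i ord0)
      = (fun xi => U x1 xi i ord0 + (- (1 - a)) * U x xi i ord0).
    apply/funext => xi; rewrite /Z /N /U.
    by move: (gradient f x1) (gradient f x) => u1 u; rewrite !mxE; ring.
  have iU' z : summable_rv PXi (fun xi => U z xi i ord0).
    by apply: L2v_coord; have [] := oracle_noise z.
  by rewrite ExD ?ExZ ?ExU ?mulr0 ?addr0 //; exact: summableZ.
have -> : (fun xi => (nsq (g1 xi - gradient f x1))%:E)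
    = (fun xi => (nsq ((1 - a) *: (g - gradient f x) + Z xi))%:E).
  apply/funext => xi; congr (nsq _)%:E; rewrite /g1 /Z /N /U.
  move: (gradient f x1) (gradient f x) => u1 u.
  by apply/matrixP => i j; rewrite !mxE; ring.
have iS : L2v PXi (fun xi => (1 - a) *: (g - gradient f x) + Z xi).
  by apply: L2vD => //; exact: L2v_cst.
rewrite -EFin_Ex; last by case: iS.
rewrite lee_fin Ex_nsq_centered // nsqZ -addrA lerD2l.
apply: (@le_trans _ _ (2 * Ex PXi (fun xi => nsq (N xi))
    + 2 * a ^+ 2 * Ex PXi (fun xi => nsq (U x1 xi)))).
  have i0 : summable_rv PXi (fun=> 0) by exact: summable_cst.
  have := @Ex_le_comb _ _ _ PXi _ _ [::] [:: (2, fun xi => nsq (N xi));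
    (2 * a ^+ 2, fun xi => nsq (U x1 xi))] (proj2 iZ) i0.
  rewrite /= Ex_cst add0r; apply.
    by move=> z [<-|[<-|//]]; [case: iN|case: iU].
  move=> xi; rewrite add0r; apply: le_trans (nsqD _ _) _; rewrite !nsqZ.
  have : (1 - a) ^+ 2 <= 1 by rewrite expr_le1 //; lra.
  by move=> /(ler_wpM2r (nsq_ge0 (N xi))); lra.
have := ler_wpM2l (sqr_ge0 a) bU; lra.
Qed.

Lemma momentum_increment :
  (\int[PXi]_xi (nsq (g1 xi - g))%:E <=
    (3 * L ^+ 2 * nsq (x1 - x) + 3 * a ^+ 2 * nsq (g - gradient f x)
      + 3 * a ^+ 2 * V ^+ 2)%:E)%E.
Proof.
have [iD bD] := oracle_diff x1 x; have [iU bU] := oracle_noise x.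
have E xi : g1 xi - g = (G x1 xi - G x xi) + (- a) *: (g - gradient f x) + a *: U x xi.
  rewrite /g1 /U; move: (gradient f x) => u; by apply/matrixP => i j; rewrite !mxE; ring.
have iS : L2v PXi (fun xi => g1 xi - g).
  under eq_fun do rewrite E.
  by apply: L2vD; [apply: L2vD => //; exact: L2v_cst|exact: L2vZ].
rewrite -EFin_Ex; last by case: iS.
rewrite lee_fin.
have i0 : summable_rv PXi (fun=> 3 * a ^+ 2 * nsq (g - gradient f x)).
  exact: summable_cst.
have := @Ex_le_comb _ _ _ PXi _ _ [::] [:: (3, fun xi => nsq (G x1 xi - G x xi));
  (3 * a ^+ 2, fun xi => nsq (U x xi))] (proj2 iS) i0.
rewrite /= Ex_cst => h; apply: le_trans (h _ _) _.
- by move=> z [<-|[<-|//]]; [case: iD|case: iU].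
- by move=> xi; rewrite E; apply: le_trans (nsqD3 _ _ _) _; rewrite !nsqZ; lra.
- by have := ler_wpM2l (sqr_ge0 a) bU; lra.
Qed.

End one_sample.

End oracle.

(** * Averaging over the current sample *)

Section past.
Context {R : realType} {d dXi : measure_display} {Omega : measurableType d}
  {Xi : measurableType dXi}.
Variables (P : probability Omega R) (PXi : probability Xi R).
Variable xi : nat -> {mfun Omega >-> Xi}.

Definition past_gen (k : nat) : set (set Omega) :=
  \big[setU/set0]_(i < k) preimage_set_system setT (xi i) measurable.

Definition past k := g_sigma_algebraType (past_gen k).

Lemma past_genP k B : past_gen k B <->
  exists2 i, (i < k)%N & preimage_set_system setT (xi i) measurable B.
Proof.
rewrite /past_gen -(bigcup_mkord k (fun i => preimage_set_system setT (xi i) measurable)).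
by split=> -[i ik Bi]; exists i.
Qed.

Lemma measurable_id_past k : measurable_fun setT (id : Omega -> past k).
Proof.
apply: (@measurability _ _ _ (past k) _ _ (past_gen k)) => // _ [B + <-].
move=> /past_genP[i ik [C mC <-]]; rewrite setTI preimage_id.
by have : measurable_fun setT (xi i) by []; apply.
Qed.

Lemma measurable_sample_past k i : (i < k)%N ->
  measurable_fun setT (fun w : past k => xi i w).
Proof.
move=> ik _ B mB; apply: sub_sigma_algebra; apply/past_genP.
by exists i => //; exists B.
Qed.

Hypothesis iid : sample_sequence P PXi xi.

(** The current sample is independent of the past, so it can be averaged out
    with the past frozen. *)
Lemma past_average k (h : Omega -> Xi -> R) (B : Omega -> R) :
  measurable_fun setT (fun z : past k * Xi => h z.1 z.2) ->
  (forall w y, 0 <= h w y) -> summable_rv P B ->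
  (forall w, (\int[PXi]_y (h w y)%:E <= (B w)%:E)%E) ->
  summable_rv P (fun w => h w (xi k w)) /\
  Ex P (fun w => h w (xi k w)) <= Ex P B.
Proof.
move=> mh h0 iB hB; have [law indep] := iid.
have mid : measurable_fun setT (id : Omega -> past k) by exact: measurable_id_past.
have mxi : measurable_fun setT (xi k) by [].
have mhE : measurable_fun setT (fun z : past k * Xi => (h z.1 z.2)%:E).
  exact/measurable_EFinP.
apply: summable_bound.
- exact: measurableT_comp mh (measurable_fun_pair mid mxi).
- by move=> w; exact: h0.
have E := @integral_indep R _ _ _ _ (past k) _ P PXi id (xi k) mid mxi _
  (fun z => (h z.1 z.2)%:E) mhE.
rewrite E; first last.
- by move=> z; rewrite lee_fin h0.
- move=> C D mC mD; rewrite preimage_id setIC.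
  have -> : P (xi k @^-1` D `&` C) = (P (xi k @^-1` D) * P C)%E.
    by apply: (indep k) => //; exists D => //; rewrite setTI.
  by rewrite muleC; congr (_ * _)%E; exact: law.
rewrite EFin_Ex //; apply: ge0_le_integral => //=.
- by move=> w _; apply: integral_ge0 => y _; rewrite lee_fin.
- have mF := @measurable_fun_fubini_tonelli_F _ _ (past k) _ R PXi _ mhE.
  have hz (z : past k * Xi) : (0 <= (h z.1 z.2)%:E)%E by rewrite lee_fin.
  exact: (measurableT_comp (mF hz) mid).
- by apply/measurable_EFinP; exact: summable_measurable iB.
Qed.

End past.

(** * Runs of the algorithm and their moments *)

Section run.
Context {R : realType} {p n : nat} {dXi : measure_display} {Xi : measurableType dXi}.
Variables (A : 'M[R]_(p, n)) (b : 'cV[R]_p) (G : 'cV[R]_n -> Xi -> 'cV[R]_n).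
Variables (rho : R) (eta_ alpha_ : nat -> R) (s0 : state R p n).

Definition iterate (y : nat -> Xi) k := primal (slalm A b G rho eta_ alpha_ s0 y k).
Definition multiplier (y : nat -> Xi) k := dual (slalm A b G rho eta_ alpha_ s0 y k).
Definition momentum (y : nat -> Xi) k := direction (slalm A b G rho eta_ alpha_ s0 y k).
Definition residual y k := A *m iterate y k - b.
Definition velocity y k :=
  - (momentum y k + A^T *m multiplier y k + rho *: (A^T *m residual y k)).

Lemma iterateS y k : iterate y k.+1 = iterate y k + eta_ k.+1 *: velocity y k.
Proof.
rewrite /velocity /residual /iterate /momentum /multiplier /=.
by case: (slalm _ _ _ _ _ _ _ _ k) => x l g /=; rewrite scalerN.
Qed.

Lemma multiplierS y k : multiplier y k.+1 = multiplier y k + rho *: residual y k.+1.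
Proof.
rewrite /residual /iterate /multiplier /=.
by case: (slalm _ _ _ _ _ _ _ _ k).
Qed.

Lemma momentumS y k : momentum y k.+1 = G (iterate y k.+1) (y k)
  + (1 - alpha_ k.+1) *: (momentum y k - G (iterate y k) (y k)).
Proof.
rewrite /iterate /momentum /=.
by case: (slalm _ _ _ _ _ _ _ _ k).
Qed.

Lemma residualS y k : residual y k.+1 = residual y k + eta_ k.+1 *: (A *m velocity y k).
Proof. by rewrite /residual iterateS mulmxDr -scalemxAr addrAC. Qed.

Hypothesis G_meas : jointly_measurable G.

Lemma vmeas_run d (T : measurableType d) (ys : T -> nat -> Xi) k :
  (forall i, (i < k)%N -> measurable_fun setT (fun t => ys t i)) ->
  [/\ vmeas (fun t => iterate (ys t) k), vmeas (fun t => multiplier (ys t) k)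
    & vmeas (fun t => momentum (ys t) k)].
Proof.
elim: k => [|k IH] mys; first by split; exact: vmeas_cst.
have [mX mL mg] := IH (fun i ik => mys i (ltnW ik)).
have mv : vmeas (fun t => velocity (ys t) k).
  apply: vmeasN; apply: vmeasD; first by apply: vmeasD mg (vmeas_mulmx _ mL).
  apply: vmeasZ; apply: vmeas_mulmx; apply: vmeasD; last exact: vmeas_cst.
  exact: vmeas_mulmx.
have mX1 : vmeas (fun t => iterate (ys t) k.+1).
  by under eq_fun do rewrite iterateS; apply: vmeasD mX (vmeasZ _ mv).
have my : measurable_fun setT (fun t => ys t k) by exact: mys.
split => //.
  under eq_fun do rewrite multiplierS; apply: vmeasD mL (vmeasZ _ _).
  by apply: vmeasD; [exact: vmeas_mulmx|exact: vmeas_cst].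
under eq_fun do rewrite momentumS.
apply: vmeasD; first exact: vmeas_oracle_comp.
apply: vmeasZ; apply: vmeasD mg (vmeasN _); exact: vmeas_oracle_comp.
Qed.

Lemma vmeas_velocity d (T : measurableType d) (ys : T -> nat -> Xi) k :
  (forall i, (i < k)%N -> measurable_fun setT (fun t => ys t i)) ->
  vmeas (fun t => velocity (ys t) k).
Proof.
move=> /vmeas_run[mX mL mg].
apply: vmeasN; apply: vmeasD; first by apply: vmeasD mg (vmeas_mulmx _ mL).
apply: vmeasZ; apply: vmeas_mulmx; apply: vmeasD; last exact: vmeas_cst.
exact: vmeas_mulmx.
Qed.

End run.

Section uniform_moments.
Context {R : realType} {dXi : measure_display} {Xi : measurableType dXi}.
Variable PXi : probability Xi R.
Implicit Types (n : nat) (S : (nat -> Xi) -> R).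

(** The bound must not depend on the probability space that carries the
    samples, only on their common law. *)
Definition bounded_mean (S : (nat -> Xi) -> R) := exists M : R,
  forall (dO : measure_display) (Omega : measurableType dO)
    (P : probability Omega R) (xi : nat -> {mfun Omega >-> Xi}),
    sample_sequence P PXi xi ->
    summable_rv P (fun w => S (fun j => xi j w)) /\
    `|Ex P (fun w => S (fun j => xi j w))| <= M.

Definition random_vector n (Z : (nat -> Xi) -> 'cV[R]_n) :=
  forall (dO : measure_display) (Omega : measurableType dO)
    (xi : nat -> {mfun Omega >-> Xi}), vmeas (fun w => Z (fun j => xi j w)).

Definition bounded_moment n (Z : (nat -> Xi) -> 'cV[R]_n) :=
  random_vector Z /\ bounded_mean (fun y => nsq (Z y)).

Lemma bounded_meanD S S' : bounded_mean S -> bounded_mean S' ->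
  bounded_mean (fun y => S y + S' y).
Proof.
move=> [M hM] [M' hM']; exists (M + M') => dO Omega P xi iid.
have [iS bS] := hM _ _ _ _ iid; have [iS' bS'] := hM' _ _ _ _ iid.
split; first exact: summableD.
by rewrite ExD // (le_trans (ler_normD _ _)) // lerD.
Qed.

Lemma bounded_meanZ a S : bounded_mean S -> bounded_mean (fun y => a * S y).
Proof.
move=> [M hM]; exists (`|a| * M) => dO Omega P xi iid.
have [iS bS] := hM _ _ _ _ iid; split; first exact: summableZ.
by rewrite ExZ // normrM ler_wpM2l.
Qed.

Lemma bounded_mean_cst a : bounded_mean (fun _ => a).
Proof.
by exists `|a| => dO Omega P xi _; split; [exact: summable_cst|rewrite Ex_cst].
Qed.

Lemma bounded_mean_le S S' :
  (forall (dO : measure_display) (Omega : measurableType dO)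
    (xi : nat -> {mfun Omega >-> Xi}),
    measurable_fun setT (fun w => S (fun j => xi j w))) ->
  (forall y, `|S y| <= S' y) -> bounded_mean S' -> bounded_mean S.
Proof.
move=> mS SS' [M hM]; exists M => dO Omega P xi iid.
have [iS' bS'] := hM _ _ _ _ iid.
have iS : summable_rv P (fun w => S (fun j => xi j w)).
  by apply: summable_le iS' => // w; exact: SS'.
split=> //; apply: le_trans (le_trans (ler_norm _) bS').
rewrite ler_norml; apply/andP; split; last first.
  by apply: Ex_le => // w; apply: le_trans (SS' _); exact: ler_norm.
rewrite lerNl -mulN1r -ExZ //; apply: Ex_le => //; first exact: summableZ.
by move=> w; apply: le_trans (SS' _); rewrite mulN1r ler_normr lexx orbT.
Qed.

Lemma bounded_momentD n (Z Z' : (nat -> Xi) -> 'cV[R]_n) :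
  bounded_moment Z -> bounded_moment Z' -> bounded_moment (fun y => Z y + Z' y).
Proof.
move=> [mZ bZ] [mZ' bZ']; split; first by move=> *; exact: vmeasD.
apply: (@bounded_mean_le _ (fun y => 2 * nsq (Z y) + 2 * nsq (Z' y))).
- by move=> *; apply: measurable_nsq; exact: vmeasD.
- by move=> y; rewrite ger0_norm ?nsq_ge0 ?nsqD.
- by apply: bounded_meanD; exact: bounded_meanZ.
Qed.

Lemma bounded_momentZ n a (Z : (nat -> Xi) -> 'cV[R]_n) :
  bounded_moment Z -> bounded_moment (fun y => a *: Z y).
Proof.
move=> [mZ bZ]; split; first by move=> *; exact: vmeasZ.
by under eq_fun do rewrite nsqZ; exact: bounded_meanZ.
Qed.

Lemma bounded_momentN n (Z : (nat -> Xi) -> 'cV[R]_n) :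
  bounded_moment Z -> bounded_moment (fun y => - Z y).
Proof. by move=> bZ; under eq_fun do rewrite -scaleN1r; exact: bounded_momentZ. Qed.

Lemma bounded_momentM q n (A : 'M[R]_(q, n)) (Z : (nat -> Xi) -> 'cV[R]_n) :
  bounded_moment Z -> bounded_moment (fun y => A *m Z y).
Proof.
move=> [mZ bZ]; split; first by move=> *; exact: vmeas_mulmx.
apply: (@bounded_mean_le _ (fun y => frob_sq A * nsq (Z y))).
- by move=> *; apply: measurable_nsq; exact: vmeas_mulmx.
- by move=> y; rewrite ger0_norm ?nsq_ge0 ?nsq_mulmx.
- exact: bounded_meanZ.
Qed.

Lemma bounded_moment_cst n (c : 'cV[R]_n) : bounded_moment (fun _ => c).
Proof. by split; [move=> *; exact: vmeas_cst|exact: bounded_mean_cst]. Qed.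

Lemma bounded_mean_dot n (Z Z' : (nat -> Xi) -> 'cV[R]_n) :
  bounded_moment Z -> bounded_moment Z' -> bounded_mean (fun y => dotv (Z y) (Z' y)).
Proof.
move=> [mZ bZ] [mZ' bZ'].
apply: (@bounded_mean_le _ (fun y => nsq (Z y) + nsq (Z' y))).
- by move=> *; exact: measurable_dotv.
- move=> y; rewrite ler_norml; apply/andP.
  have := dotv_young 1 (Z y) (Z' y); have := dotv_young (- 1) (Z y) (Z' y).
  have := nsq_ge0 (Z y); have := nsq_ge0 (Z' y).
  by move=> *; split; lra.
- exact: bounded_meanD.
Qed.

Lemma bounded_moment_L2v n (Z : (nat -> Xi) -> 'cV[R]_n)
    (dO : measure_display) (Omega : measurableType dO)
    (P : probability Omega R) (xi : nat -> {mfun Omega >-> Xi}) :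
  sample_sequence P PXi xi -> bounded_moment Z ->
  L2v P (fun w => Z (fun j => xi j w)).
Proof.
by move=> iid [mZ [M hM]]; split; [exact: mZ|have [] := hM _ _ _ _ iid].
Qed.

End uniform_moments.

(** * Recursion for a scalar potential *)

Section scalar_recursion.
Context {R : realType}.
Variables (L m rho c1 V : R).
Hypotheses (L_gt0 : 0 < L) (m_gt0 : 0 < m) (mL : m * L <= 1 / 448).
Let c := 121 * L ^+ 2.
Let beta := 1 / (8 * L ^+ 2).

Definition noise_constant : R :=
  (24 * m ^+ 2 * c ^+ 2 + 3 * m * c ^+ 2 + 2 * beta * c ^+ 2) * V ^+ 2.

Let c_gt0 : 0 < c. Proof. by rewrite mulr_gt0 // exprn_gt0. Qed.
Let beta_gt0 : 0 < beta. Proof. by rewrite divr_gt0 // mulr_gt0 // exprn_gt0. Qed.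

Lemma noise_constant_ge0 : 0 <= noise_constant.
Proof.
have m0 := ltW m_gt0; have b0 := ltW beta_gt0.
apply: mulr_ge0 (sqr_ge0 _); apply: addr_ge0; first apply: addr_ge0.
- by apply: mulr_ge0 (sqr_ge0 _); apply: mulr_ge0 => //; exact: sqr_ge0.
- by apply: mulr_ge0 (sqr_ge0 _); exact: mulr_ge0.
- by apply: mulr_ge0 (sqr_ge0 _); exact: mulr_ge0.
Qed.

(** [beta c = 121 / 8] and [2 beta L^2 = 1 / 4]: weighted by [beta / h], the
    contraction of the gradient error absorbs the error of the descent step,
    and its noise is absorbed by the descent. *)
Lemma weighted_error (h h' Ee1 Ee2 EV1 : R) :
  0 < h -> 0 < h' -> 0 <= Ee1 ->
  c * h ^+ 2 <= 1 -> 1 / h - 1 / h' <= 8 * L ^+ 2 * h ->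
  Ee2 <= (1 - c * h ^+ 2) ^+ 2 * Ee1 + 2 * L ^+ 2 * h ^+ 2 * EV1
    + 2 * (c * h ^+ 2) ^+ 2 * V ^+ 2 ->
  beta / h * Ee2 <= beta / h' * Ee1 - 14 * h * Ee1 + h / 4 * EV1
    + 2 * beta * c ^+ 2 * V ^+ 2 * h ^+ 3.
Proof.
move=> h0 h'0 e0 ch tau S.
have bh : 0 < beta / h by rewrite divr_gt0.
have cont : beta / h * ((1 - c * h ^+ 2) ^+ 2 * Ee1) <= (beta / h' - 14 * h) * Ee1.
  rewrite mulrA; apply: ler_wpM2r => //.
  have a0 : 0 <= c * h ^+ 2 by rewrite mulr_ge0 ?sqr_ge0 // ltW.
  have h1 : beta / h * (1 - c * h ^+ 2) ^+ 2 <= beta / h * (1 - c * h ^+ 2).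
    by apply: ler_wpM2l; [exact: ltW|rewrite expr2; nra].
  apply: le_trans h1 _.
  have -> : beta / h * (1 - c * h ^+ 2) = beta * (1 / h) - 121 / 8 * h.
    by rewrite /beta /c; field; rewrite !gt_eqF.
  have -> : beta / h' = beta * (1 / h') by rewrite div1r.
  have : beta * (1 / h - 1 / h') <= beta * (8 * L ^+ 2 * h).
    by apply: ler_wpM2l => //; exact: ltW.
  have -> : beta * (8 * L ^+ 2 * h) = h by rewrite /beta; field; rewrite gt_eqF.
  by lra.
have := ler_wpM2l (ltW bh) S.
have -> : beta / h * ((1 - c * h ^+ 2) ^+ 2 * Ee1 + 2 * L ^+ 2 * h ^+ 2 * EV1
    + 2 * (c * h ^+ 2) ^+ 2 * V ^+ 2) = beta / h * ((1 - c * h ^+ 2) ^+ 2 * Ee1)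
    + h / 4 * EV1 + 2 * beta * c ^+ 2 * V ^+ 2 * h ^+ 3.
  by rewrite /beta; field; rewrite !gt_eqF.
lra.
Qed.

(** The increments of the estimator have mean square of order [h'^2], so that even
    with the weight [4 m^2 / h] they contribute at order [h'] only, and [m L] is
    small enough for the coefficient of [EV0]. *)
Lemma weighted_increment (h h' Ee0 EV0 EG : R) :
  0 < h -> 0 < h' -> h' <= 1 -> h' <= 2 * h -> 0 <= Ee0 -> 0 <= EV0 ->
  192 * m * L ^+ 2 * h' <= 1 -> 48 * m ^+ 2 * c ^+ 2 * h' <= 1 ->
  6 * m * c ^+ 2 * h' <= 1 ->
  EG <= 3 * L ^+ 2 * h' ^+ 2 * EV0 + 3 * (c * h' ^+ 2) ^+ 2 * Ee0
    + 3 * (c * h' ^+ 2) ^+ 2 * V ^+ 2 ->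
  (4 * m ^+ 2 / h + m) * EG <= h' / 32 * EV0 + h' * Ee0
    + (24 * m ^+ 2 * c ^+ 2 + 3 * m * c ^+ 2) * V ^+ 2 * h' ^+ 3.
Proof.
move=> h0 h'0 h'1 hh e0 v0 s1 s2 s3 I.
pose B := 4 * m ^+ 2 / h + m.
have B0 : 0 <= B.
  by apply: addr_ge0; [apply: divr_ge0; rewrite ?mulr_ge0 ?sqr_ge0|]; rewrite // ltW.
have Bh : B * h' <= 8 * m ^+ 2 + m * h'.
  rewrite mulrDl lerD2r mulrAC ler_pdivrMr //.
  by have := ler_wpM2l (sqr_ge0 m) hh; lra.
have mp := ltW m_gt0.
have mm : 0 <= m ^+ 2 by rewrite sqr_ge0.
have cc : 0 <= c ^+ 2 by rewrite sqr_ge0.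
have h'2 : h' ^+ 2 <= h' by rewrite expr2; nra.
have h'3 : h' ^+ 3 <= h' ^+ 2 by rewrite exprS; nra.
have h'30 : 0 <= h' ^+ 3 by rewrite exprn_ge0 // ltW.
have mL2 : m ^+ 2 * L ^+ 2 <= 1 / 1536.
  have ml0 : 0 <= m * L by rewrite mulr_ge0 // ltW.
  have ml : m * L <= 1 / 64 by move: mL; lra.
  by rewrite -exprMn expr2; have := ler_pM ml0 ml0 ml ml; lra.
have k1 : B * (3 * L ^+ 2 * h' ^+ 2) <= h' / 32.
  have -> : B * (3 * L ^+ 2 * h' ^+ 2) = 3 * L ^+ 2 * h' * (B * h') by ring.
  have c0 : 0 <= 3 * L ^+ 2 * h' by rewrite mulr_ge0 ?(ltW h'0) // mulr_ge0 ?sqr_ge0.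
  apply: le_trans (ler_wpM2l c0 Bh) _.
  have e1 : 3 * L ^+ 2 * h' * (8 * m ^+ 2 + m * h')
    = 24 * (m ^+ 2 * L ^+ 2) * h' + 1 / 64 * (192 * m * L ^+ 2 * h') * h' by field.
  rewrite e1; have := ler_wpM2r (ltW h'0) mL2; have := ler_wpM2r (ltW h'0) s1.
  by lra.
have k2 : B * (3 * (c * h' ^+ 2) ^+ 2) <=
    (24 * m ^+ 2 * c ^+ 2 + 3 * m * c ^+ 2) * h' ^+ 3.
  have -> : B * (3 * (c * h' ^+ 2) ^+ 2) = 3 * c ^+ 2 * h' ^+ 3 * (B * h') by ring.
  have c0 : 0 <= 3 * c ^+ 2 * h' ^+ 3 by rewrite mulr_ge0 // mulr_ge0.
  apply: le_trans (ler_wpM2l c0 Bh) _.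
  have := ler_wpM2l (mulr_ge0 c0 mp) h'1; lra.
have k3 : (24 * m ^+ 2 * c ^+ 2 + 3 * m * c ^+ 2) * h' ^+ 3 <= h'.
  have -> : (24 * m ^+ 2 * c ^+ 2 + 3 * m * c ^+ 2) * h' ^+ 3 =
    (1 / 2 * (48 * m ^+ 2 * c ^+ 2 * h') + 1 / 2 * (6 * m * c ^+ 2 * h')) * h' ^+ 2.
    by field.
  apply: le_trans h'2; rewrite -[leRHS]mul1r ler_wpM2r ?sqr_ge0 //; lra.
have := ler_wpM2l B0 I; rewrite -/B.
have := ler_wpM2r v0 k1; have := ler_wpM2r e0 (le_trans k2 k3).
have := ler_wpM2r (sqr_ge0 V) k2.
lra.
Qed.

(** Summing the three inequalities leaves the coefficients
    [- 3/8 + 1/4 + 1/16 = - 1/16] for [h EV1] and [1/2 - 14 + 1 < - 1] for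
    [h Ee1]. The terms [h / 16 EV1] and [h Ee1] of the potential are there to
    cancel the leftovers [h' / 32 EV0] and [h' Ee0] one step later. *)
Lemma potential_recursion (h h' h2 EL0 EL1 ER0 ER1 EV0 EV1 Ee0 Ee1 Ee2 EG : R) :
  0 < h -> 0 < h' -> h <= h' -> h' <= 1 -> h' <= 2 * h ->
  0 <= Ee0 -> 0 <= Ee1 -> 0 <= EV0 -> 0 <= EV1 ->
  c * h ^+ 2 <= 1 -> 1 / h - 1 / h' <= 8 * L ^+ 2 * h ->
  192 * m * L ^+ 2 * h' <= 1 -> 48 * m ^+ 2 * c ^+ 2 * h' <= 1 ->
  6 * m * c ^+ 2 * h' <= 1 ->
  EG <= 3 * L ^+ 2 * h' ^+ 2 * EV0 + 3 * (c * h' ^+ 2) ^+ 2 * Ee0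
    + 3 * (c * h' ^+ 2) ^+ 2 * V ^+ 2 ->
  Ee2 <= (1 - c * h ^+ 2) ^+ 2 * Ee1 + 2 * L ^+ 2 * h ^+ 2 * EV1
    + 2 * (c * h ^+ 2) ^+ 2 * V ^+ 2 ->
  EL1 + m * rho / 2 * (1 / h2) * ER1 + m / 2 * EV1 + c1 * rho / 2 * ER1
      + 3 / 8 * h * EV1
    <= EL0 + m * rho / 2 * (1 / h) * ER0 + m / 2 * EV0 + h / 2 * Ee1
      + (4 * m ^+ 2 / h + m) * EG + h' / 32 * EV0 ->
  (EL1 + m * rho / 2 * (1 / h2) * ER1 + m / 2 * EV1 + beta / h * Ee2
      + h / 16 * EV1 + h * Ee1)
    + (h / 16 * EV1 + h * Ee1 + c1 * rho / 2 * ER1)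
  <= (EL0 + m * rho / 2 * (1 / h) * ER0 + m / 2 * EV0 + beta / h' * Ee1
      + h' / 16 * EV0 + h' * Ee0) + noise_constant * h' ^+ 3.
Proof.
move=> h0 h'0 hh' h'1 hh e0 e1 v0 v1 ch tau s1 s2 s3 I S D.
have WE := weighted_error h0 h'0 e1 ch tau S.
have WI := weighted_increment h0 h'0 h'1 hh e0 v0 s1 s2 s3 I.
have h3 : h ^+ 3 <= h' ^+ 3 by rewrite ler_pXn2r // nnegrE ltW.
have k0 : 0 <= 2 * beta * c ^+ 2 * V ^+ 2.
  apply: mulr_ge0 (sqr_ge0 _); apply: mulr_ge0 (sqr_ge0 _).
  by apply: mulr_ge0 => //; exact: ltW.
have := ler_wpM2l k0 h3; rewrite /noise_constant.
have : 0 <= h * Ee1 by rewrite mulr_ge0 // ltW.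
have : 0 <= h * EV1 by rewrite mulr_ge0 // ltW.
lra.
Qed.

End scalar_recursion.

Section decreasing_potential.
Context {R : realType}.

(** A potential [phi] that decreases up to summable errors and whose sums are
    bounded below is itself bounded below: once below [- S] it would stay there
    and its sums would tend to minus infinity. *)
Lemma sum_decrease_le (phi D u ell : nat -> R) (N : nat) (S : R) :
  (forall k, (N <= k)%N -> phi k.+1 + D k <= phi k + u k) ->
  (forall k, 0 <= D k) -> (forall n M, \sum_(n <= k < M) u k <= S) ->
  (forall k, 0 <= ell k) -> (forall k, ell k.+1 - ell k <= phi k) ->
  forall M, \sum_(N <= k < M) D k <= `|phi N| + 2 * S.
Proof.
move=> rec D0 uS ell0 phi_ge.
have S0 : 0 <= S by have := uS 0%N 0%N; rewrite big_geq.
have tel n j : (N <= n)%N ->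
    phi (n + j)%N + \sum_(n <= k < n + j) D k <= phi n + \sum_(n <= k < n + j) u k.
  move=> Nn; elim: j => [|j IH]; first by rewrite addn0 !big_geq.
  rewrite addnS !big_nat_recr ?leq_addr //=.
  have := rec (n + j)%N (leq_trans Nn (leq_addr _ _)).
  by move: IH; set s1 := \sum_(_ <= _ < _) _; set s2 := \sum_(_ <= _ < _) _; lra.
have D0s n M : 0 <= \sum_(n <= k < M) D k by apply: sumr_ge0.
have phi_le n j : (N <= n)%N -> phi (n + j)%N <= phi n + S.
  by move=> Nn; have := tel n j Nn; have := D0s n (n + j)%N; have := uS n (n + j)%N; lra.
have phi_low n : (N <= n)%N -> - S <= phi n.
  move=> Nn; rewrite leNgt; apply/negP => lo.
  pose a := - (phi n + S); have a0 : 0 < a by rewrite /a; lra.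
  have sumJ J : ell (n + J)%N - ell n <= - (J%:R * a).
    elim: J => [|J IH]; first by rewrite addn0 subrr mul0r oppr0.
    have := phi_le n J Nn; have := phi_ge (n + J)%N.
    by rewrite addnS -natr1 mulrDl mul1r /a; move: IH; rewrite /a; lra.
  have := sumJ (Num.truncn (ell n / a)).+1; have := ell0 (n + (Num.truncn (ell n / a)).+1)%N.
  have := truncnS_gt (ell n / a); rewrite ltr_pdivrMr //.
  by move: (_%:R * a) => z; lra.
move=> M; have [MN|/ltnW NM] := leqP M N.
  by rewrite big_geq // addr_ge0 ?mulr_ge0.
have := tel N (M - N)%N (leqnn N); rewrite subnKC //.
have := phi_low M NM; have := uS N M; have := ler_norm (phi N); lra.
Qed.

End decreasing_potential.

(** * Convergence along the run *)

Section convergence.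
Context {R : realType} {p n : nat} {dXi : measure_display} {Xi : measurableType dXi}.
Variables (PXi : probability Xi R) (f : 'cV[R]_n -> R) (G : 'cV[R]_n -> Xi -> 'cV[R]_n).
Variables (A : 'M[R]_(p, n)) (b : 'cV[R]_p) (L V delta m rho c1 : R).
Variables (eta_ alpha_ : nat -> R) (s0 : state R p n).
Hypothesis f_diff : forall x, differentiable f x.
Hypothesis f_ge0 : forall x, 0 <= f x.
Hypothesis G_meas : jointly_measurable G.
Hypothesis G_int : forall x i, PXi.-integrable setT (fun xi => (G x xi i ord0)%:E).
Hypothesis G_mean : forall x i,
  ('E_PXi[fun xi => G x xi i ord0] = (gradient f x i ord0)%:E)%E.
Hypothesis G_lip : forall u v,
  ('E_PXi[fun xi => (enorm (G u xi - G v xi) ^+ 2)%R]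
     <= (L ^+ 2 * enorm (u - v) ^+ 2)%R%:E)%E.
Hypothesis G_var : forall x,
  ('E_PXi[fun xi => (enorm (G x xi - gradient f x) ^+ 2)%R] <= (V ^+ 2)%R%:E)%E.
Hypothesis feasible : exists x, A *m x = b.
Hypothesis delta_def : smallest_nonzero_eigenvalue (A^T *m A) delta.
Hypotheses (L_gt0 : 0 < L) (m_gt0 : 0 < m) (rho_gt0 : 0 < rho) (c1_gt0 : 0 < c1).
Hypotheses (mL : m * L <= 1 / 448) (rho_ge : 7 * (1 + c1) <= rho * m * delta).
Hypothesis eta_gt0 : forall k, 0 < eta_ k.
Hypothesis eta_le : forall i j, (i <= j)%N -> eta_ j <= eta_ i.
Hypothesis alphaE : forall k, alpha_ k = 121 * L ^+ 2 * eta_ k ^+ 2.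

Let X := iterate A b G rho eta_ alpha_ s0.
Let Lm := multiplier A b G rho eta_ alpha_ s0.
Let g := momentum A b G rho eta_ alpha_ s0.
Let r := residual A b G rho eta_ alpha_ s0.
Let v := velocity A b G rho eta_ alpha_ s0.
Let e y k := g y k - gradient f (X y k).

Let XS y k : X y k.+1 = X y k + eta_ k.+1 *: v y k.
Proof. exact: iterateS. Qed.

Let LmS y k : Lm y k.+1 = Lm y k + rho *: r y k.+1.
Proof. exact: multiplierS. Qed.

Let gS y k : g y k.+1 = G (X y k.+1) (y k)
  + (1 - alpha_ k.+1) *: (g y k - G (X y k) (y k)).
Proof. exact: momentumS. Qed.

Let rS y k : r y k.+1 = r y k + eta_ k.+1 *: (A *m v y k).
Proof. exact: residualS. Qed.

Let gl := gradient_lipschitz G_meas G_int G_mean G_lip.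

Lemma bounded_moment_gradient (Z : (nat -> Xi) -> 'cV[R]_n) :
  bounded_moment PXi Z -> bounded_moment PXi (fun y => gradient f (Z y)).
Proof.
move=> [mZ bZ].
have mg : random_vector (fun y => gradient f (Z y)).
  move=> dO Omega xi i; apply: (@measurable_continuous_comp _ _ _ _
    (fun x => gradient f x i ord0)); last exact: mZ.
  exact: (gradient_continuous G_meas G_int G_mean G_lip).
split => //.
apply: (@bounded_mean_le _ _ _ _ _ (fun y => 2 * nsq (gradient f 0) + 2 * L ^+ 2 * nsq (Z y))).
- by move=> *; exact: measurable_nsq.
- move=> y; rewrite ger0_norm ?nsq_ge0 //.
  have := nsqD (gradient f 0) (gradient f (Z y) - gradient f 0).
  rewrite addrC subrK; have := gl (Z y) 0; rewrite subr0; lra.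
- apply: bounded_meanD; first exact: bounded_mean_cst.
  exact: bounded_meanZ.
Qed.

Lemma bounded_mean_objective (Z : (nat -> Xi) -> 'cV[R]_n) :
  bounded_moment PXi Z -> bounded_mean PXi (fun y => f (Z y)).
Proof.
move=> bZ; have [mZ nZ] := bZ.
apply: (@bounded_mean_le _ _ _ _ _
  (fun y => f 0 + dotv (gradient f 0) (Z y) + L * nsq (Z y))).
- move=> *; apply: measurable_continuous_comp; last exact: mZ.
  by move=> x; exact: differentiable_continuous.
- move=> y; rewrite ger0_norm //.
  by have := descent f_diff (ltW L_gt0) gl 0 (Z y); rewrite add0r.
- apply: bounded_meanD; last exact: bounded_meanZ.
  apply: bounded_meanD; first exact: bounded_mean_cst.
  by apply: bounded_mean_dot => //; exact: bounded_moment_cst.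
Qed.

Section sampling.
Context {dO : measure_display} {Omega : measurableType dO}.
Variables (P : probability Omega R) (xi : nat -> {mfun Omega >-> Xi}).
Hypothesis iid : sample_sequence P PXi xi.
Local Notation "Y @@ w" := (Y (fun j => xi j w)) (at level 10).

Let past_state k (T := (past xi k * Xi)%type) :
  [/\ vmeas (fun z : T => X @@ z.1 k), vmeas (fun z : T => X @@ z.1 k.+1),
      vmeas (fun z : T => g @@ z.1 k)
    & measurable_fun setT (snd : T -> Xi)].
Proof.
have my i : (i < k)%N -> measurable_fun setT (fun w : past xi k => xi i w).
  exact: measurable_sample_past.
have [mX mLm mg] := vmeas_run A b rho eta_ alpha_ s0 G_meas my.
have mv := vmeas_velocity A b rho eta_ alpha_ s0 G_meas my.
have m1 : measurable_fun setT (fst : T -> past xi k) by exact: measurable_fst.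
split; [exact: vmeas_comp m1 mX| |exact: vmeas_comp m1 mg|exact: measurable_snd].
under eq_fun do rewrite XS.
by apply: vmeasD; [exact: vmeas_comp m1 mX|apply: vmeasZ; exact: vmeas_comp m1 mv].
Qed.

Lemma increment_mean k (B := fun w => 3 * L ^+ 2 * nsq (X @@ w k.+1 - X @@ w k)
    + 3 * alpha_ k.+1 ^+ 2 * nsq (e @@ w k) + 3 * alpha_ k.+1 ^+ 2 * V ^+ 2) :
  summable_rv P B ->
  summable_rv P (fun w => nsq (g @@ w k.+1 - g @@ w k)) /\
  Ex P (fun w => nsq (g @@ w k.+1 - g @@ w k)) <= Ex P B.
Proof.
move=> iB; under eq_fun do rewrite gS.
have [mX mX1 mg my] := past_state k.
apply: (past_average iid (h := fun w y => nsq (G (X @@ w k.+1) y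
    + (1 - alpha_ k.+1) *: (g @@ w k - G (X @@ w k) y) - g @@ w k))) => //.
- apply: measurable_nsq; apply: vmeasD; last exact: vmeasN.
  apply: vmeasD; first exact: vmeas_oracle_comp.
  apply: vmeasZ; apply: vmeasD mg (vmeasN _); exact: vmeas_oracle_comp.
- by move=> *; exact: nsq_ge0.
- by move=> w; exact: momentum_increment.
Qed.

Lemma error_mean k (B := fun w => (1 - alpha_ k.+1) ^+ 2 * nsq (e @@ w k)
    + 2 * L ^+ 2 * nsq (X @@ w k.+1 - X @@ w k) + 2 * alpha_ k.+1 ^+ 2 * V ^+ 2) :
  0 <= alpha_ k.+1 <= 1 -> summable_rv P B ->
  Ex P (fun w => nsq (e @@ w k.+1)) <= Ex P B.
Proof.
move=> a01 iB; rewrite /e; under eq_fun do rewrite gS.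
have [mX mX1 mg my] := past_state k.
apply: (proj2 (past_average iid (h := fun w y => nsq (G (X @@ w k.+1) y
    + (1 - alpha_ k.+1) *: (g @@ w k - G (X @@ w k) y) - gradient f (X @@ w k.+1)))
  _ _ iB _)) => //.
- apply: measurable_nsq; apply: vmeasD; last first.
    apply: vmeasN => i; apply: (@measurable_continuous_comp _ _ _ _
      (fun x => gradient f x i ord0)); last exact: mX1.
    exact: (gradient_continuous G_meas G_int G_mean G_lip).
  apply: vmeasD; first exact: vmeas_oracle_comp.
  apply: vmeasZ; apply: vmeasD mg (vmeasN _); exact: vmeas_oracle_comp.
- by move=> *; exact: nsq_ge0.
- by move=> w; exact: momentum_error.
Qed.

End sampling.

(** Only the gradient estimator involves the samples; its second moment is
    bounded through [increment_mean], and the other updates are linear. *)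
Lemma run_moments k : [/\ bounded_moment PXi (X^~ k), bounded_moment PXi (Lm^~ k)
  & bounded_moment PXi (g^~ k)].
Proof.
elim: k => [|k [bX bL bg]]; first by split; exact: bounded_moment_cst.
have br : bounded_moment PXi (r^~ k).
  apply: bounded_momentD; first exact: bounded_momentM.
  exact: bounded_moment_cst.
have bv : bounded_moment PXi (v^~ k).
  apply: bounded_momentN; apply: bounded_momentD; last first.
    by apply: bounded_momentZ; exact: bounded_momentM.
  by apply: bounded_momentD => //; exact: bounded_momentM.
have bX1 : bounded_moment PXi (X^~ k.+1).
  by under eq_fun do rewrite XS; apply: bounded_momentD => //; exact: bounded_momentZ.
have be : bounded_moment PXi (e^~ k).
  by apply: bounded_momentD bg (bounded_momentN (bounded_moment_gradient bX)).
have bdX : bounded_moment PXi (fun y => X y k.+1 - X y k).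
  exact: bounded_momentD bX1 (bounded_momentN bX).
have mg1 : random_vector (g^~ k.+1).
  move=> dO Omega xi.
  have [|_ _ //] := vmeas_run A b rho eta_ alpha_ s0 G_meas
    (ys := fun w j => xi j w) (k := k.+1).
  by move=> i _.
have bdg : bounded_moment PXi (fun y => g y k.+1 - g y k).
  split; first by move=> dO Omega xi; apply: vmeasD (mg1 _ _ _) (vmeasN (proj1 bg _ _ _)).
  have : bounded_mean PXi (fun y => 3 * L ^+ 2 * nsq (X y k.+1 - X y k)
    + 3 * alpha_ k.+1 ^+ 2 * nsq (e y k) + 3 * alpha_ k.+1 ^+ 2 * V ^+ 2).
    apply: bounded_meanD; last exact: bounded_mean_cst.
    apply: bounded_meanD; apply: bounded_meanZ; [exact: (proj2 bdX)|exact: (proj2 be)].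
  move=> [M hM]; exists M => dO Omega P xi iid.
  have [iB bB] := hM _ _ _ _ iid.
  have [iI bI] := increment_mean iid iB; split => //.
  rewrite ger0_norm; last by apply: Ex_ge0 => w; exact: nsq_ge0.
  exact: le_trans bI (le_trans (ler_norm _) bB).
split => //.
  under eq_fun do rewrite LmS; apply: bounded_momentD => //.
  apply: bounded_momentZ; apply: bounded_momentD; first exact: bounded_momentM.
  exact: bounded_moment_cst.
have -> : g^~ k.+1 = (fun y => (g y k.+1 - g y k) + g y k).
  by apply/funext => y; rewrite subrK.
exact: bounded_momentD.
Qed.

Let bX k : bounded_moment PXi (X^~ k). Proof. by have [] := run_moments k. Qed.
Let bL k : bounded_moment PXi (Lm^~ k). Proof. by have [] := run_moments k. Qed.
Let bg k : bounded_moment PXi (g^~ k). Proof. by have [] := run_moments k. Qed.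

Let br k : bounded_moment PXi (r^~ k).
Proof.
apply: bounded_momentD; first exact: bounded_momentM.
exact: bounded_moment_cst.
Qed.

Let bv k : bounded_moment PXi (v^~ k).
Proof.
apply: bounded_momentN; apply: bounded_momentD; last first.
  by apply: bounded_momentZ; exact: bounded_momentM.
by apply: bounded_momentD => //; exact: bounded_momentM.
Qed.

Let be k : bounded_moment PXi (e^~ k).
Proof.
by apply: bounded_momentD (bg k) (bounded_momentN (bounded_moment_gradient (bX k))).
Qed.

Let c := 121 * L ^+ 2.
Let a2 := frob_sq A.

(** Collected so that they hold simultaneously from some iteration on, where
    [pathwise_descent] and [potential_recursion] apply. *)
Definition small_steps k (h' := eta_ k.+1) (h := eta_ k.+2) (h2 := eta_ k.+3) :=
  [/\ h' <= 1, h' <= 2 * h, rho * a2 * h <= 1 / 28, (L + rho * a2) * h <= 1 / 16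
    & m * h' * (1 / h - 1 / h') ^+ 2 <= 1 / 4] /\
  [/\ m * (1 / h2 - 1 / h) <= c1, 1 / h - 1 / h' <= 8 * L ^+ 2 * h
    & c * h ^+ 2 <= 1] /\
  [/\ 192 * m * L ^+ 2 * h' <= 1, 48 * m ^+ 2 * c ^+ 2 * h' <= 1
    & 6 * m * c ^+ 2 * h' <= 1].

Hypothesis eta_small : forall kappa, 0 < kappa ->
  exists N, forall k, (N <= k)%N -> eta_ k <= kappa.
Hypothesis eta_incr : forall kappa, 0 < kappa ->
  exists N, forall k, (N <= k)%N -> 1 / eta_ k.+1 - 1 / eta_ k <= kappa * eta_ k.+1.

(** [Q] and [Q'] collect the constants of the conditions that bound the step
    size and the increment of its inverse, respectively. *)
Lemma small_steps_eventually : exists N, forall k, (N <= k)%N -> small_steps k.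
Proof.
have a20 : 0 <= rho * a2 by rewrite mulr_ge0 ?frob_ge0 // ltW.
have c0 : 0 < c by rewrite mulr_gt0 // exprn_gt0.
pose Q := 1 + 28 * (rho * a2) + 16 * (L + rho * a2) + 4 * m + c + 192 * m * L ^+ 2
  + 48 * m ^+ 2 * c ^+ 2 + 6 * m * c ^+ 2.
have mp := m_gt0; have Lp := L_gt0.
have q1 : 0 < m * L ^+ 2 by rewrite mulr_gt0 ?exprn_gt0.
have q2 : 0 < m ^+ 2 * c ^+ 2 by rewrite mulr_gt0 ?exprn_gt0.
have q3 : 0 < m * c ^+ 2 by rewrite mulr_gt0 ?exprn_gt0.
have [[Q1 Q28 Q16 Q4] [Qc Q192 Q48 Q6]] :
    [/\ 1 <= Q, 28 * (rho * a2) <= Q, 16 * (L + rho * a2) <= Q & 4 * m <= Q] /\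
    [/\ c <= Q, 192 * m * L ^+ 2 <= Q, 48 * m ^+ 2 * c ^+ 2 <= Q
      & 6 * m * c ^+ 2 <= Q].
  by rewrite /Q; split; split; lra.
pose Q' := 1 + 1 / (8 * L ^+ 2) + m / c1.
have L8 : 0 < 8 * L ^+ 2 by rewrite mulr_gt0 ?exprn_gt0.
have [Q'1 Q'L Q'c] : [/\ 1 <= Q', 1 / (8 * L ^+ 2) <= Q' & m / c1 <= Q'].
  have : 0 < 1 / (8 * L ^+ 2) by rewrite divr_gt0.
  have : 0 < m / c1 by rewrite divr_gt0.
  by rewrite /Q'; split; lra.
have Q0 : 0 < Q := lt_le_trans ltr01 Q1.
have Q'0 : 0 < Q' := lt_le_trans ltr01 Q'1.
move: (Q) (Q') Q0 Q'0 Q1 Q28 Q16 Q4 Qc Q192 Q48 Q6 Q'1 Q'L Q'c => {Q Q' q1 q2 q3} Q Q'.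
move=> Q0 Q'0 Q1 Q28 Q16 Q4 Qc Q192 Q48 Q6 Q'1 Q'L Q'c.
have [N1 hN1] := eta_small (divr_gt0 ltr01 Q0).
have [N2 hN2] := eta_incr (divr_gt0 ltr01 Q'0).
exists (maxn N1 N2) => k; rewrite geq_max => /andP[k1 k2].
rewrite /small_steps; set h' := eta_ k.+1; set h := eta_ k.+2; set h2 := eta_ k.+3.
have h'0 : 0 < h' by exact: eta_gt0.
have h0 : 0 < h by exact: eta_gt0.
have h20 : 0 < h2 by exact: eta_gt0.
have hh' : h <= h' by exact: eta_le.
have hh2 : h2 <= h by exact: eta_le.
have part q z : q <= Q -> 0 <= z <= h' -> q * z <= 1.
  move=> qQ /andP[z0 zh]; apply: (@le_trans _ _ (Q * h')).
    by apply: le_trans (ler_wpM2r z0 qQ) _; rewrite ler_wpM2l // ltW.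
  have := hN1 k.+1 (leq_trans k1 (leqnSn k)).
  by rewrite -/h' ler_pdivlMr // [h' * _]mulrC.
have Q'K z : Q' * (1 / Q' * z) = z by field; rewrite gt_eqF.
have inv_ge0 (x y : R) : 0 < x -> x <= y -> 0 <= 1 / x - 1 / y.
  by move=> x0 xy; rewrite subr_ge0 !div1r lef_pV2 ?posrE // (lt_le_trans x0).
have tau0 := inv_ge0 _ _ h0 hh'; have tau20 := inv_ge0 _ _ h20 hh2.
have t1 q : q <= Q' -> q * (1 / h - 1 / h') <= h.
  move=> qQ; apply: le_trans (ler_wpM2r tau0 qQ) _; rewrite -[leRHS]Q'K.
  by apply: ler_wpM2l (ltW Q'0) _ _ (hN2 k.+1 (leq_trans k2 (leqnSn k))).
have t2 q : q <= Q' -> q * (1 / h2 - 1 / h) <= h2.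
  move=> qQ; apply: le_trans (ler_wpM2r tau20 qQ) _; rewrite -[leRHS]Q'K.
  by apply: ler_wpM2l (ltW Q'0) _ _ (hN2 k.+2 (leq_trans k2 (leqW (leqnSn k)))).
have tE : h' - h = h * h' * (1 / h - 1 / h') by field; rewrite !gt_eqF.
move: (1 / h - 1 / h') (1 / h2 - 1 / h) tau0 tau20 t1 t2 tE => tau tau2.
move=> tau0 tau20 t1 t2 tE.
have h'1 : h' <= 1 by rewrite -[h']mul1r; apply: part => //; rewrite lexx ltW.
have tau1 : tau <= 1.
  by have := t1 _ Q'1; rewrite mul1r => /le_trans -> //; exact: le_trans h'1.
have ht : h' * tau <= 1 by rewrite -[leRHS]mulr1 ler_pM // ltW.
have hh : 0 <= h <= h' by rewrite hh' ltW.
have h'h' : 0 <= h' <= h' by rewrite lexx ltW.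
split; [split|split; split] => //; try exact: part.
- have : h * (h' * tau) <= h * 1 by rewrite ler_wpM2l // ltW.
  by lra.
- by have := part _ _ Q28 hh; lra.
- by have := part _ _ Q16 hh; lra.
- have : m * h' * tau ^+ 2 <= m * h' * 1.
    by apply: ler_wpM2l; [rewrite mulr_ge0 ?ltW|rewrite expr_le1].
  by have := part _ _ Q4 h'h'; lra.
- have := le_trans (t2 _ Q'c) (le_trans hh2 (le_trans hh' h'1)).
  by rewrite mulrAC ler_pdivrMr // mul1r.
- have := t1 _ Q'L.
  by rewrite mulrAC mul1r ler_pdivrMr // [h * _]mulrC.
- have : c * h ^+ 2 <= c * h'.
    rewrite ler_wpM2l ?(ltW c0) // expr2 -[leRHS]mulr1.
    by rewrite ler_pM ?(ltW h0) // (le_trans hh').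
  by have := part _ _ Qc h'h'; lra.
Qed.

Section means.
Context {dO : measure_display} {Omega : measurableType dO}.
Variables (P : probability Omega R) (xi : nat -> {mfun Omega >-> Xi}).
Hypothesis iid : sample_sequence P PXi xi.
Local Notation "Y @@ w" := (Y (fun j => xi j w)) (at level 10).

Let Lag y k := augmented_lagrangian rho (f (X y k)) (Lm y k) (r y k).
Definition mean_lagrangian k := Ex P (fun w => Lag @@ w k).
Definition mean_velocity k := Ex P (fun w => nsq (v @@ w k)).
Definition mean_error k := Ex P (fun w => nsq (e @@ w k)).
Definition mean_residual k := Ex P (fun w => nsq (r @@ w k)).

(** The residual and the velocity terms are those of [pathwise_descent]; the
    error at iteration [k.+1] has the weight of [weighted_error]; the last two
    terms compensate the lower order terms at iteration [k]. *)
Definition mean_potential k := mean_lagrangian k.+1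
  + m * rho / 2 * (1 / eta_ k.+2) * mean_residual k.+1 + m / 2 * mean_velocity k
  + 1 / (8 * L ^+ 2) / eta_ k.+1 * mean_error k.+1
  + eta_ k.+1 / 16 * mean_velocity k + eta_ k.+1 * mean_error k.

Definition mean_decrease k := eta_ k.+2 / 16 * mean_velocity k.+1
  + eta_ k.+2 * mean_error k.+1 + c1 * rho / 2 * mean_residual k.+2.

Let sL k : L2v P (fun w => Lm @@ w k).
Proof. exact: bounded_moment_L2v iid (bL k). Qed.

Let sg k : L2v P (fun w => g @@ w k).
Proof. exact: bounded_moment_L2v iid (bg k). Qed.

Let sr k : L2v P (fun w => r @@ w k).
Proof. exact: bounded_moment_L2v iid (br k). Qed.

Let sv k : L2v P (fun w => v @@ w k).
Proof. exact: bounded_moment_L2v iid (bv k). Qed.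

Let se k : L2v P (fun w => e @@ w k).
Proof. exact: bounded_moment_L2v iid (be k). Qed.

Let sLag k : summable_rv P (fun w => Lag @@ w k).
Proof.
apply: summableD; last by apply: summableZ; exact: (proj2 (sr k)).
apply: summableD; last exact: L2v_dot (sL k) (sr k).
by have [M hM] := bounded_mean_objective (bX k); have [] := hM _ _ _ _ iid.
Qed.

Let dX y k : X y k.+1 - X y k = eta_ k.+1 *: v y k.
Proof. by rewrite XS addrAC subrr add0r. Qed.

Let mean_increment_le k :
  Ex P (fun w => nsq (g @@ w k.+1 - g @@ w k)) <=
  3 * L ^+ 2 * eta_ k.+1 ^+ 2 * mean_velocity k
  + 3 * (c * eta_ k.+1 ^+ 2) ^+ 2 * mean_error k + 3 * (c * eta_ k.+1 ^+ 2) ^+ 2 * V ^+ 2.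
Proof.
have [|_] := @increment_mean _ _ P xi iid k.
  under eq_fun do rewrite dX.
  apply: summableD; last exact: summable_cst.
  apply: summableD; apply: summableZ; last exact: (proj2 (se k)).
  exact: (proj2 (L2vZ _ (sv k))).
move=> /le_trans; apply; rewrite alphaE -/c.
under eq_fun do rewrite dX nsqZ mulrA.
have i1 a : summable_rv P (fun w => a * nsq (v @@ w k)).
  by apply: summableZ; exact: (proj2 (sv k)).
have i2 a : summable_rv P (fun w => a * nsq (e @@ w k)).
  by apply: summableZ; exact: (proj2 (se k)).
rewrite ExD; [|exact: summableD|exact: summable_cst].
rewrite ExD // Ex_cst (ExZ _ (proj2 (sv k))) (ExZ _ (proj2 (se k))).
by [].
Qed.

Let mean_error_le k : c * eta_ k.+1 ^+ 2 <= 1 ->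
  mean_error k.+1 <= (1 - c * eta_ k.+1 ^+ 2) ^+ 2 * mean_error k
  + 2 * L ^+ 2 * eta_ k.+1 ^+ 2 * mean_velocity k
  + 2 * (c * eta_ k.+1 ^+ 2) ^+ 2 * V ^+ 2.
Proof.
move=> ch.
have a01 : 0 <= alpha_ k.+1 <= 1.
  by rewrite alphaE ch andbT mulr_ge0 ?sqr_ge0 // mulr_ge0 ?sqr_ge0.
have i1 a : summable_rv P (fun w => a * nsq (v @@ w k)).
  by apply: summableZ; exact: (proj2 (sv k)).
have i2 a : summable_rv P (fun w => a * nsq (e @@ w k)).
  by apply: summableZ; exact: (proj2 (se k)).
apply: le_trans (error_mean iid a01 _) _; rewrite alphaE -/c.
  under eq_fun do rewrite dX nsqZ mulrA.
  by apply: summableD; [exact: summableD|exact: summable_cst].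
under eq_fun do rewrite dX nsqZ mulrA.
rewrite ExD; [|exact: summableD|exact: summable_cst].
rewrite ExD // Ex_cst (ExZ _ (proj2 (se k))) (ExZ _ (proj2 (sv k))).
by [].
Qed.

Lemma mean_potential_recursion k : small_steps k ->
  mean_potential k.+1 + mean_decrease k <=
  mean_potential k + noise_constant L m V * eta_ k.+1 ^+ 3.
Proof.
move=> [[s1 s2 s3 s4 s5] [[s6 s7 s8] [s9 s10 s11]]].
have nn q (Z : Omega -> 'cV[R]_q) : 0 <= Ex P (fun w => nsq (Z w)).
  by apply: Ex_ge0 => w; exact: nsq_ge0.
have rec := @potential_recursion _ L m rho c1 V L_gt0 m_gt0 mL (eta_ k.+2)
  (eta_ k.+1) (eta_ k.+3)
  (mean_lagrangian k.+1) (mean_lagrangian k.+2) (mean_residual k.+1)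
  (mean_residual k.+2) (mean_velocity k) (mean_velocity k.+1) (mean_error k)
  (mean_error k.+1) (mean_error k.+2)
  (Ex P (fun w => nsq (g @@ w k.+1 - g @@ w k)))
  (eta_gt0 _) (eta_gt0 _) (eta_le (leqnSn _)) s1 s2 (nn _ _) (nn _ _) (nn _ _)
  (nn _ _) s8 s7 s9 s10 s11 (mean_increment_le k) (mean_error_le s8).
apply: rec => {s1 s2 s7 s8 s9 s10 s11}.
have [xs xsb] := feasible.
have i q (Z : Omega -> 'cV[R]_q) : L2v P Z -> summable_rv P (fun w => nsq (Z w)).
  by case.
apply: (@Ex_le_comb _ _ _ P (fun w => Lag @@ w k.+2) (fun w => Lag @@ w k.+1)
  [:: (m * rho / 2 * (1 / eta_ k.+3), fun w => nsq (r @@ w k.+2));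
      (m / 2, fun w => nsq (v @@ w k.+1));
      (c1 * rho / 2, fun w => nsq (r @@ w k.+2));
      (3 / 8 * eta_ k.+2, fun w => nsq (v @@ w k.+1))]
  [:: (m * rho / 2 * (1 / eta_ k.+2), fun w => nsq (r @@ w k.+1));
      (m / 2, fun w => nsq (v @@ w k));
      (eta_ k.+2 / 2, fun w => nsq (e @@ w k.+1));
      (4 * m ^+ 2 / eta_ k.+2 + m, fun w => nsq (g @@ w k.+1 - g @@ w k));
      (eta_ k.+1 / 32, fun w => nsq (v @@ w k))] (sLag _) (sLag _)).
  by move=> z [<-|[<-|[<-|[<-|[<-|[<-|[<-|[<-|[<-|//]]]]]]]]];
    apply: i => //; apply: L2vB.
move=> w.
set y := fun j => xi j w.
have tE : eta_ k.+1 - eta_ k.+2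
    = eta_ k.+2 * eta_ k.+1 * (1 / eta_ k.+2 - 1 / eta_ k.+1).
  by field; rewrite !gt_eqF.
rewrite /Lag (LmS y k.+1).
apply: (pathwise_descent m_gt0 rho_gt0 (x1 := X y k.+2 - xs) delta_def rho_ge
  (eta_gt0 k.+2) (eta_gt0 k.+1) tE s3 s4 s5 s6 (gr := gradient f (X y k.+1))
  (l' := Lm y k) (r' := r y k)) => //.
- by rewrite /e addrC subrK.
- by rewrite mulmxBr xsb.
- have := descent f_diff (ltW L_gt0) gl (X y k.+1) (eta_ k.+2 *: v y k.+1).
  by rewrite -(XS y k.+1) dotvZr nsqZ mulrA.
Qed.

(** The dual update makes [dotv l r] a telescoping quantity from below. *)
Lemma mean_lagrangian_ge k :
  1 / (2 * rho) * Ex P (fun w => nsq (Lm @@ w k.+1))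
    - 1 / (2 * rho) * Ex P (fun w => nsq (Lm @@ w k)) <= mean_lagrangian k.+1.
Proof.
have i0 : summable_rv P (fun=> 0) by exact: summable_cst.
have := @Ex_le_comb _ _ _ P _ _
  [:: (1 / (2 * rho), fun w => nsq (Lm @@ w k.+1));
      (- (1 / (2 * rho)), fun w => nsq (Lm @@ w k))] [::] i0 (sLag k.+1).
rewrite /= Ex_cst add0r mulNr; apply.
  by move=> z [<-|[<-|//]]; exact: (proj2 (sL _)).
move=> w; rewrite add0r mulNr.
set y := fun j => xi j w; rewrite /Lag /augmented_lagrangian.
have E : Lm y k = Lm y k.+1 - rho *: r y k.+1 by rewrite LmS addrK.
have -> : nsq (Lm y k) = nsq (Lm y k.+1) - 2 * rho * dotv (Lm y k.+1) (r y k.+1)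
    + rho ^+ 2 * nsq (r y k.+1).
  move: E; move: (Lm y k) (Lm y k.+1) (r y k.+1) => l0 l1 r1 ->.
  by rewrite /nsq !dotvE (dotvC r1); ring.
have := f_ge0 (X y k.+1).
have : 0 <= rho * nsq (r y k.+1) by rewrite mulr_ge0 ?nsq_ge0 // ltW.
have -> : 1 / (2 * rho) * nsq (Lm y k.+1) - 1 / (2 * rho) *
  (nsq (Lm y k.+1) - 2 * rho * dotv (Lm y k.+1) (r y k.+1) + rho ^+ 2 * nsq (r y k.+1))
  = dotv (Lm y k.+1) (r y k.+1) - rho / 2 * nsq (r y k.+1) by field; rewrite gt_eqF.
lra.
Qed.

End means.

Definition stationarity y k := gradient f (X y k) + A^T *m Lm y k.

(** By the primal update, [A^T l] is [- v - g] up to the residual term, which the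
    dual update compensates up to order [h]; hence stationarity is controlled by
    [v] and [e]. *)
Lemma stationarity_le y k (h := eta_ k.+1) : (L + rho * a2) * h <= 1 / 16 ->
  nsq (stationarity y k.+1) <= 8 * nsq (v y k) + 4 * nsq (e y k).
Proof.
move=> hs.
have h0 : 0 < h by exact: eta_gt0.
have a20 : 0 <= a2 by exact: frob_ge0.
pose d1 := gradient f (X y k.+1) - gradient f (X y k).
pose d4 := (rho * h) *: (A^T *m (A *m v y k)).
have -> : stationarity y k.+1 = (d1 + - e y k) + (- v y k + d4).
  have vE : v y k = - (g y k + A^T *m Lm y k + rho *: (A^T *m r y k)) by [].
  have -> : d4 = rho *: (A^T *m (h *: (A *m v y k))) by rewrite -scalemxAr scalerA.
  have aL : A^T *m Lm y k.+1 = A^T *m Lm y k + rho *: (A^T *m r y k)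
      + rho *: (A^T *m (h *: (A *m v y k))).
    by rewrite LmS rS mulmxDr -scalemxAr mulmxDr scalerDr addrA.
  rewrite /stationarity aL /d1 /e vE.
  move: (gradient f (X y k.+1)) (gradient f (X y k)) (g y k) (A^T *m Lm y k)
    (rho *: (A^T *m r y k)) (rho *: (A^T *m (h *: (A *m v y k)))) => u1 u2 u3 u4 u5 u6.
  by apply/matrixP => i j; rewrite !mxE; ring.
have b1 : nsq d1 <= (L * h) ^+ 2 * nsq (v y k).
  apply: le_trans (gl _ _) _; rewrite XS addrAC subrr add0r nsqZ -/h.
  by rewrite exprMn mulrA.
have b4 : nsq d4 <= (rho * a2 * h) ^+ 2 * nsq (v y k).
  rewrite nsqZ.
  have q : nsq (A^T *m (A *m v y k)) <= a2 * (a2 * nsq (v y k)).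
    by apply: le_trans (nsq_mulmx_tr A _) _; rewrite ler_wpM2l // nsq_mulmx.
  have := ler_wpM2l (sqr_ge0 (rho * h)) q.
  by congr (_ <= _); ring.
have Lh : 0 <= L * h by rewrite mulr_ge0 ?ltW.
have rh : 0 <= rho * a2 * h by rewrite mulr_ge0 ?mulr_ge0 ?(ltW h0) // ltW.
have sq : (L * h) ^+ 2 + (rho * a2 * h) ^+ 2 <= 1.
  have s1 : L * h <= 1 / 2 by lra.
  have s2 : rho * a2 * h <= 1 / 2 by lra.
  by rewrite !expr2; have := ler_pM Lh Lh s1 s1; have := ler_pM rh rh s2 s2; lra.
have := ler_wpM2r (nsq_ge0 (v y k)) sq.
have := nsqD (d1 + - e y k) (- v y k + d4).
have := nsqD d1 (- e y k); have := nsqD (- v y k) d4.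
rewrite (nsqN (e y k)) (nsqN (v y k)); lra.
Qed.

Lemma bounded_moment_stationarity k : bounded_moment PXi (stationarity^~ k).
Proof.
apply: bounded_momentD (bounded_moment_gradient (bX k)) _.
exact: bounded_momentM (bL k).
Qed.

Section bounds.
Context {dO : measure_display} {Omega : measurableType dO}.
Variables (P : probability Omega R) (xi : nat -> {mfun Omega >-> Xi}).
Hypothesis iid : sample_sequence P PXi xi.
Local Notation "Y @@ w" := (Y (fun j => xi j w)) (at level 10).

Lemma mean_stationarity_le k : small_steps k ->
  Ex P (fun w => nsq (stationarity @@ w k.+2)) <=
  128 / eta_ k.+2 * mean_decrease P xi k.
Proof.
move=> [[_ _ _ hs _] _].
have sv := proj2 (bounded_moment_L2v iid (bv k.+1)).
have se := proj2 (bounded_moment_L2v iid (be k.+1)).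
have ss := proj2 (bounded_moment_L2v iid (bounded_moment_stationarity k.+2)).
have i0 : summable_rv P (fun=> 0) by exact: summable_cst.
have := @Ex_le_comb _ _ _ P _ _ [::] [:: (8, fun w => nsq (v @@ w k.+1));
  (4, fun w => nsq (e @@ w k.+1))] ss i0.
rewrite /= Ex_cst add0r => /(_ _ _)/le_trans; apply.
- by move=> z [<-|[<-|//]].
- by move=> w; rewrite add0r; exact: stationarity_le.
have h0 := eta_gt0 k.+2.
have -> : 128 / eta_ k.+2 * mean_decrease P xi k = 8 * mean_velocity P xi k.+1
    + 128 * mean_error P xi k.+1
    + 128 / eta_ k.+2 * (c1 * rho / 2 * mean_residual P xi k.+2).
  by rewrite /mean_decrease; field; rewrite gt_eqF.
have e0 : 0 <= mean_error P xi k.+1 by apply: Ex_ge0 => w; exact: nsq_ge0.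
have r0 : 0 <= mean_residual P xi k.+2 by apply: Ex_ge0 => w; exact: nsq_ge0.
have : 0 <= 128 / eta_ k.+2 * (c1 * rho / 2 * mean_residual P xi k.+2).
  apply: mulr_ge0; first by rewrite divr_ge0 // ltW.
  by apply: mulr_ge0 r0; rewrite divr_ge0 // mulr_ge0 // ltW.
rewrite /mean_velocity /mean_error in e0 *; lra.
Qed.

Lemma mean_residual_le k :
  mean_residual P xi k.+2 <= 2 / (c1 * rho) * mean_decrease P xi k.
Proof.
have h0 := eta_gt0 k.+2; have cr : 0 < c1 * rho by rewrite mulr_gt0.
have -> : 2 / (c1 * rho) * mean_decrease P xi k = mean_residual P xi k.+2
    + 2 / (c1 * rho) * (eta_ k.+2 / 16 * mean_velocity P xi k.+1
      + eta_ k.+2 * mean_error P xi k.+1).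
  by rewrite /mean_decrease; field; rewrite !gt_eqF.
rewrite lerDl; apply: mulr_ge0; first by rewrite divr_ge0 // ltW.
apply: addr_ge0; apply: mulr_ge0; rewrite ?divr_ge0 ?(ltW h0) //;
  by apply: Ex_ge0 => w; exact: nsq_ge0.
Qed.

Lemma mean_decrease_ge0 k : 0 <= mean_decrease P xi k.
Proof.
have h0 := eta_gt0 k.+2; have cr : 0 < c1 * rho by rewrite mulr_gt0.
by apply: addr_ge0; first apply: addr_ge0; apply: mulr_ge0;
  rewrite ?divr_ge0 ?(ltW h0) ?(ltW cr) //; apply: Ex_ge0 => w; exact: nsq_ge0.
Qed.

Lemma mean_potential_ge k : mean_lagrangian P xi k.+1 <= mean_potential P xi k.
Proof.
have p0 (a : R) (Z : Omega -> R) : 0 <= a -> (forall w, 0 <= Z w) -> 0 <= a * Ex P Z.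
  by move=> a0 Z0; apply: mulr_ge0 => //; exact: Ex_ge0.
have mp := ltW m_gt0; have rp := ltW rho_gt0.
have h1 := ltW (eta_gt0 k.+1); have h2 := ltW (eta_gt0 k.+2).
rewrite /mean_potential -!addrA lerDl.
have t1 : 0 <= m * rho / 2 * (1 / eta_ k.+2).
  by apply: mulr_ge0; apply: divr_ge0 => //; exact: mulr_ge0.
have t2 : 0 <= m / 2 by exact: divr_ge0.
have t3 : 0 <= 1 / (8 * L ^+ 2) / eta_ k.+1.
  by apply: divr_ge0 => //; apply: divr_ge0 => //; rewrite mulr_ge0 ?sqr_ge0.
have t4 : 0 <= eta_ k.+1 / 16 by exact: divr_ge0.
apply: addr_ge0; first by apply: (p0 _ _ t1) => w; exact: nsq_ge0.
apply: addr_ge0; first by apply: (p0 _ _ t2) => w; exact: nsq_ge0.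
apply: addr_ge0; first by apply: (p0 _ _ t3) => w; exact: nsq_ge0.
apply: addr_ge0; first by apply: (p0 _ _ t4) => w; exact: nsq_ge0.
by apply: (p0 _ _ h1) => w; exact: nsq_ge0.
Qed.

End bounds.

Lemma mean_potential_bounded k : exists M, forall (dO : measure_display)
    (Omega : measurableType dO) (P : probability Omega R)
    (xi : nat -> {mfun Omega >-> Xi}), sample_sequence P PXi xi ->
  `|mean_potential P xi k| <= M.
Proof.
have bLag : bounded_mean PXi
    (fun y => augmented_lagrangian rho (f (X y k.+1)) (Lm y k.+1) (r y k.+1)).
  apply: bounded_meanD; last by apply: bounded_meanZ; exact: (proj2 (br _)).
  apply: bounded_meanD; first exact: bounded_mean_objective.
  exact: bounded_mean_dot.
have bnd (a : R) q (Z : (nat -> Xi) -> 'cV[R]_q) : bounded_moment PXi Z ->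
    exists M, forall (dO : measure_display)
    (Omega : measurableType dO) (P : probability Omega R)
    (xi : nat -> {mfun Omega >-> Xi}), sample_sequence P PXi xi ->
    `|a * Ex P (fun w => nsq (Z (fun j => xi j w)))| <= M.
  move=> [_ [M hM]]; exists (`|a| * M) => dO Omega P xi iid.
  by rewrite normrM ler_wpM2l //; exact: (proj2 (hM _ _ _ _ iid)).
have [M0 h0] := bLag.
have [M1 h1] := bnd (m * rho / 2 * (1 / eta_ k.+2)) _ _ (br k.+1).
have [M2 h2] := bnd (m / 2) _ _ (bv k).
have [M3 h3] := bnd (1 / (8 * L ^+ 2) / eta_ k.+1) _ _ (be k.+1).
have [M4 h4] := bnd (eta_ k.+1 / 16) _ _ (bv k).
have [M5 h5] := bnd (eta_ k.+1) _ _ (be k).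
exists (M0 + M1 + M2 + M3 + M4 + M5) => dO Omega P xi iid.
have nD (x x' B B' : R) : `|x| <= B -> `|x'| <= B' -> `|x + x'| <= B + B'.
  by move=> hx hx'; apply: le_trans (ler_normD _ _) _; exact: lerD.
apply: (nD _ _ _ _ _ (h5 _ _ _ _ iid)); apply: (nD _ _ _ _ _ (h4 _ _ _ _ iid)).
apply: (nD _ _ _ _ _ (h3 _ _ _ _ iid)); apply: (nD _ _ _ _ _ (h2 _ _ _ _ iid)).
apply: (nD _ _ _ _ _ (h1 _ _ _ _ iid)); exact: (proj2 (h0 _ _ _ _ iid)).
Qed.

Hypothesis eta_cubes : exists2 S, 0 <= S &
  forall i N, \sum_(i <= k < N) eta_ k.+1 ^+ 3 <= S.

(** Sums of the expected squares along the run: the early terms are bounded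
    moments, and the late ones are controlled by the decrease of the potential. *)
Lemma ergodic_bound : exists2 C, 0 <= C & forall (dO : measure_display)
    (Omega : measurableType dO) (P : probability Omega R)
    (xi : nat -> {mfun Omega >-> Xi}), sample_sequence P PXi xi ->
  forall K, (0 < K)%N ->
  \sum_(1 <= j < K.+1) Ex P (fun w => nsq (stationarity (fun j => xi j w) j))
    <= C / eta_ K /\
  \sum_(1 <= j < K.+1) Ex P (fun w => nsq (r (fun j => xi j w) j)) <= C / eta_ K.
Proof.
have [N hN] := small_steps_eventually.
have [S S0 hS] := eta_cubes.
have [Mp hMp] := mean_potential_bounded N.
have early q (Z : (nat -> Xi) -> nat -> 'cV[R]_q) :
    (forall k, bounded_moment PXi (Z^~ k)) ->
    exists2 M, 0 <= M & forall (dO : measure_display)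
    (Omega : measurableType dO) (P : probability Omega R)
    (xi : nat -> {mfun Omega >-> Xi}), sample_sequence P PXi xi ->
    \sum_(1 <= j < N.+2) Ex P (fun w => nsq (Z (fun j => xi j w) j)) <= M.
  move=> bZ; elim: (N.+1) => [|i [M M0 IH]].
    by exists 0 => // dO Omega P xi iid; rewrite big_geq.
  have [_ [Mi hMi]] := bZ i.+1; exists (M + `|Mi|); first exact: addr_ge0.
  move=> dO Omega P xi iid; rewrite big_nat_recr //=; apply: lerD; first exact: IH.
  apply: le_trans (le_trans (ler_norm _) _) (ler_norm Mi).
  exact: (proj2 (hMi _ _ _ _ iid)).
have [Ms Ms0 hMs] := early _ _ bounded_moment_stationarity.
have [Mr Mr0 hMr] := early _ _ br.
pose W := noise_constant L m V.
have W0 : 0 <= W by exact: noise_constant_ge0.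
pose S' := `|Mp| + 2 * (W * S).
have S'0 : 0 <= S' by rewrite addr_ge0 // mulr_ge0 // mulr_ge0.
have cr : 0 < c1 * rho by rewrite mulr_gt0.
pose Q := 128 + 2 / (c1 * rho) * eta_ 1%N.
have Q0 : 0 <= 2 / (c1 * rho) * eta_ 1%N.
  by rewrite mulr_ge0 ?(ltW (eta_gt0 _)) // divr_ge0 // ltW.
exists ((Ms + Mr) * eta_ 1%N + Q * S').
  apply: addr_ge0; first exact: mulr_ge0 (addr_ge0 Ms0 Mr0) (ltW (eta_gt0 _)).
  by apply: mulr_ge0 S'0; exact: addr_ge0.
move=> dO Omega P xi iid K K0.
have eK := eta_gt0 K.
have D0 := mean_decrease_ge0 P xi.
have sumD M : \sum_(N <= k < M) mean_decrease P xi k <= S'.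
  apply: le_trans (@sum_decrease_le _ (mean_potential P xi) (mean_decrease P xi)
    (fun k => W * eta_ k.+1 ^+ 3)
    (fun k => 1 / (2 * rho) * Ex P (fun w => nsq (Lm (fun j => xi j w) k)))
    N (W * S) _ _ _ _ _ M) _.
  - by move=> k Nk; apply: mean_potential_recursion => //; exact: hN.
  - exact: D0.
  - by move=> i j; rewrite -mulr_sumr ler_wpM2l.
  - move=> k; apply: mulr_ge0; last by apply: Ex_ge0 => w; exact: nsq_ge0.
    by rewrite divr_ge0 // mulr_ge0 // ltW.
  - move=> k; apply: le_trans (mean_potential_ge _ _ _).
    exact: mean_lagrangian_ge.
  - rewrite /S' lerD2r; apply: le_trans (hMp _ _ _ _ iid) (ler_norm _).
have split_sum (T : nat -> R) (M B : R) : (forall j, 0 <= T j) -> 0 <= M -> 0 <= B ->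
    \sum_(1 <= j < N.+2) T j <= M ->
    (forall k, (N <= k)%N -> (k.+2 <= K)%N -> T k.+2 <= B / eta_ K * mean_decrease P xi k) ->
    \sum_(1 <= j < K.+1) T j <= (M * eta_ 1%N + B * S') / eta_ K.
  move=> T0 M0 B0 TM TB.
  have first_le : M <= M * eta_ 1%N / eta_ K.
    by rewrite ler_pdivlMr // ler_wpM2l // eta_le.
  have late : \sum_(N.+2 <= j < K.+1) T j <= B * S' / eta_ K.
    rewrite big_add1 /= big_add1 /=.
    rewrite mulrAC; apply: le_trans (ler_wpM2l (divr_ge0 B0 (ltW eK)) (sumD K.-1)).
    rewrite mulr_sumr; apply: ler_sum_nat => k /andP[Nk kK].
    by apply: TB => //; rewrite -ltn_predRL.
  have -> : (M * eta_ 1%N + B * S') / eta_ K = M * eta_ 1%N / eta_ K + B * S' / eta_ K.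
    by rewrite mulrDl.
  have [KN|NK] := leqP K.+1 N.+2; last first.
    rewrite (big_cat_nat (n := N.+2)) //=; last exact: ltnW.
    by apply: lerD => //; exact: le_trans first_le.
  apply: ler_wpDr; first by rewrite divr_ge0 ?mulr_ge0 // ltW.
  apply: le_trans (le_trans TM first_le).
  by rewrite [leRHS](big_cat_nat (n := K.+1)) //= lerDl sumr_ge0.
have nn q (Z : (nat -> Xi) -> nat -> 'cV[R]_q) j :
    0 <= Ex P (fun w => nsq (Z (fun j => xi j w) j)).
  by apply: Ex_ge0 => w; exact: nsq_ge0.
have weaken (M B : R) : 0 <= M <= Ms + Mr -> 0 <= B <= Q ->
    (M * eta_ 1%N + B * S') / eta_ K <= ((Ms + Mr) * eta_ 1%N + Q * S') / eta_ K.
  move=> /andP[M0 MM] /andP[B0 BQ]; rewrite ler_pM2r ?invr_gt0 //.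
  by apply: lerD; rewrite ler_wpM2r // ltW.
split.
- apply: le_trans (split_sum _ Ms 128 (nn _ _) Ms0 _ (hMs _ _ _ _ iid) _)
    (weaken _ _ _ _) => //.
  + move=> k Nk kK; apply: le_trans (mean_stationarity_le iid (hN k Nk)) _.
    by rewrite ler_wpM2r // ler_pM2l // lef_pV2 ?posrE // eta_le.
  + by rewrite Ms0 lerDl.
  + by apply/andP; split; [exact: ler0n|rewrite /Q lerDl].
- apply: le_trans (split_sum _ Mr (2 / (c1 * rho) * eta_ 1%N) (nn _ _) Mr0 _
    (hMr _ _ _ _ iid) _) (weaken _ _ _ _) => //.
  + move=> k Nk kK; apply: le_trans (mean_residual_le _ _ _) _.
    rewrite ler_wpM2r // ler_pdivlMr // ler_wpM2l ?eta_le //.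
    by rewrite divr_ge0 // ltW.
  + by rewrite Mr0 lerDr.
  + by apply/andP; split; [exact: Q0|rewrite /Q lerDr ler0n].
Qed.

End convergence.

(** * The random output index *)

Section random_output.
Context {R : realType} {dO dXi : measure_display} {Omega : measurableType dO}
  {Xi : measurableType dXi}.
Variables (P : probability Omega R) (xi : nat -> {mfun Omega >-> Xi}).

Definition run_gen : set (set Omega) := \bigcup_k g_sigma_algebra_preimage (xi k).

Definition run_space := g_sigma_algebraType run_gen.

Lemma measurable_id_run : measurable_fun setT (id : Omega -> run_space).
Proof.
apply: (@measurability _ _ _ run_space _ _ run_gen) => // _ [B + <-].
move=> [i _ [C mC <-]]; rewrite setTI preimage_id.
by have : measurable_fun setT (xi i) by []; apply.
Qed.

Lemma measurable_sample_run i : measurable_fun setT (fun w : run_space => xi i w).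
Proof.
by move=> _ B mB; apply: sub_sigma_algebra; exists i => //; exists B.
Qed.

Lemma measurable_enorm d (T : measurableType d) n (X : T -> 'cV[R]_n) :
  vmeas X -> measurable_fun setT (fun w => enorm (X w)).
Proof.
move=> mX.
have msqrt : measurable_fun setT (Num.sqrt : R -> R).
  by apply: continuous_measurable_fun; exact: sqrt_continuous.
apply: (measurableT_comp msqrt).
by apply: measurable_sum => i; exact: measurable_funX.
Qed.

Variables (K : nat) (khat : {mfun Omega >-> nat}).
Hypotheses (K_gt0 : (0 < K)%N) (unif : uniform_output_index P xi K khat).

Let hit j (w : Omega) : R := (khat w == j)%:R.

Let measurable_hit j : measurable_fun setT (hit j).
Proof.
have mk : measurable_fun setT khat by [].
by apply: (measurableT_comp (f := fun i : nat => (i == j)%:R : R)) mk.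
Qed.

Lemma summable_hit j (Z : Omega -> R) : (forall w, 0 <= Z w) ->
  summable_rv P Z -> summable_rv P (fun w => hit j w * Z w).
Proof.
move=> Z0 iZ; apply: (summable_ge0_le _ _ iZ) => [|w].
  by apply: measurable_funM => //; exact: summable_measurable iZ.
by rewrite mulr_ge0 ?ler0n //= /hit; case: eqP; rewrite ?mul1r ?mul0r ?lexx.
Qed.

(** The output index is independent of the run, so its value can be averaged
    with the run frozen. *)
Lemma hit_mean j (Z : Omega -> R) : (1 <= j <= K)%N ->
  measurable_fun setT (Z : run_space -> R) -> (forall w, 0 <= Z w) ->
  summable_rv P Z ->
  Ex P (fun w => hit j w * Z w) = K%:R^-1 * Ex P Z.
Proof.
move=> jK mZ Z0 iZ; have [law indep] := unif.
have mid : measurable_fun setT (id : Omega -> run_space) by exact: measurable_id_run.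
have mk : measurable_fun setT khat by [].
have iH := summable_hit j Z0 iZ.
apply: EFin_inj; rewrite EFin_Ex // EFinM EFin_Ex //.
pose h (z : run_space * nat) : \bar R := ((z.2 == j)%:R * Z z.1)%:E.
have mh : measurable_fun setT h.
  apply/measurable_EFinP; apply: measurable_funM.
    exact: (measurableT_comp (f := fun i : nat => (i == j)%:R : R) _ measurable_snd).
  exact: (measurableT_comp mZ measurable_fst).
have E := @integral_indep R _ _ _ _ run_space _ P (distribution P khat) id khat mid mk _
  h mh.
have -> : (\int[P]_w (hit j w * Z w)%:E = \int[P]_w h (id w, khat w))%E by [].
rewrite E; first last.
- by move=> z; rewrite lee_fin mulr_ge0.
- move=> C D mC mD; rewrite preimage_id setIC.
  have -> : P (khat @^-1` D `&` C) = (P (khat @^-1` D) * P C)%E.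
    by apply: indep => //; exists D => //; rewrite setTI.
  by rewrite muleC.
rewrite -ge0_integralZl_EFin //; first last.
- by apply/measurable_EFinP; exact: measurableT_comp mZ mid.
- by move=> w _; rewrite lee_fin.
apply: eq_integral => w _; rewrite /h /=.
transitivity (\int[distribution P khat]_y ((Z w)%:E * (\1_[set j] y)%:E))%E.
  apply: eq_integral => y _; rewrite indicE -EFinM mulrC; congr (_ * _%:R)%:E.
  congr nat_of_bool; apply/idP/idP => [/eqP ->|/set_mem ->]; last exact: eqxx.
  exact/mem_set.
rewrite ge0_integralZl_EFin // integral_indic // setIT.
by rewrite muleC; congr (_ * _)%E; exact: law.
Qed.

(** [enorm] is at most [eps / 2 + nsq / (2 eps)], so a small mean square bounds
    the mean norm. *)
Lemma output_mean n (S : nat -> Omega -> 'cV[R]_n) (eps : R) : 0 < eps ->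
  (forall j, vmeas (S j : run_space -> 'cV[R]_n)) -> (forall j, L2v P (S j)) ->
  \sum_(1 <= j < K.+1) Ex P (fun w => nsq (S j w)) <= eps ^+ 2 * K%:R ->
  ('E_P[fun w => enorm (S (khat w) w)] <= eps%:E)%E.
Proof.
move=> e0 mS iS sumS; have [law _] := unif.
have K0 : 0 < K%:R :> R by rewrite ltr0n.
have mid : measurable_fun setT (id : Omega -> run_space) by exact: measurable_id_run.
have mZ j : measurable_fun setT (fun w : run_space => enorm (S j w)).
  exact: measurable_enorm.
have mZO j : measurable_fun setT (fun w : Omega => enorm (S j w)).
  exact: measurableT_comp (mZ j) mid.
have young j w : enorm (S j w) <= eps / 2 + 1 / (2 * eps) * nsq (S j w).
  rewrite -sqr_enorm; set z := enorm _.
  have : 0 <= 1 / (2 * eps) * (eps - z) ^+ 2.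
    by rewrite mulr_ge0 ?sqr_ge0 // divr_ge0 // mulr_ge0 // ltW.
  have -> : 1 / (2 * eps) * (eps - z) ^+ 2
      = eps / 2 + 1 / (2 * eps) * z ^+ 2 - z by field; rewrite gt_eqF.
  by rewrite subr_ge0.
have iY j : summable_rv P (fun w => eps / 2 + 1 / (2 * eps) * nsq (S j w)).
  by apply: summableD; [exact: summable_cst|apply: summableZ; exact: (proj2 (iS j))].
have iZ j : summable_rv P (fun w => enorm (S j w)).
  by apply: summable_ge0_le (iY j) => // w; rewrite enorm_ge0 young.
have ExS j : Ex P (fun w => enorm (S j w))
    <= eps / 2 + 1 / (2 * eps) * Ex P (fun w => nsq (S j w)).
  apply: le_trans (Ex_le (iZ j) (iY j) (young j)) _.
  rewrite ExD; [|exact: summable_cst|by apply: summableZ; exact: (proj2 (iS j))].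
  by rewrite Ex_cst ExZ //; exact: (proj2 (iS j)).
pose Y w := \sum_(1 <= j < K.+1) hit j w * enorm (S j w).
have iHZ j : summable_rv P (fun w => hit j w * enorm (S j w)).
  by apply: summable_hit (iZ j) => w; exact: enorm_ge0.
have iYs : summable_rv P Y by exact: summable_sum.
have EY : Ex P Y <= eps.
  rewrite Ex_sum // (eq_big_nat _ _ (F2 := fun j => K%:R^-1 * Ex P (fun w => enorm (S j w)))).
    2: by move=> j jK; apply: hit_mean => // w; exact: enorm_ge0.
  rewrite -mulr_sumr ler_pdivrMl //.
  apply: le_trans (ler_sum_nat (fun j _ => ExS j)) _.
  rewrite big_split /= sumr_const_nat subSS subn0 -mulr_sumr.
  have i0 : 0 <= 1 / (2 * eps) by rewrite divr_ge0 // mulr_ge0 // ltW.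
  have := ler_wpM2l i0 sumS.
  have -> : 1 / (2 * eps) * (eps ^+ 2 * K%:R) = eps / 2 * K%:R by field; rewrite gt_eqF.
  by rewrite -[_ *+ K]mulr_natr; lra.
have sum1 (F : nat -> R) w : (1 <= khat w <= K)%N ->
    \sum_(1 <= j < K.+1) hit j w * F j = F (khat w).
  move=> kK; rewrite (bigD1_seq (khat w)) ?mem_index_iota ?iota_uniq //=.
  rewrite /hit eqxx mul1r big1 ?addr0 // => j jk.
  by rewrite eq_sym (negbTE jk) mul0r.
(* The output index lies in [1, K] almost surely, as the probabilities of these
   values add up to one. *)
pose N := [set w | ~~ (1 <= khat w <= K)%N].
have mN : measurable N.
  by apply: (measurable_funPTI khat (Y := [set i | ~~ (1 <= i <= K)%N])).
have PN : P N = 0%E.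
  have i1 j : summable_rv P (fun w => hit j w * 1).
    by apply: summable_hit => //; exact: summable_cst.
  have iS1 : summable_rv P (fun w => \sum_(1 <= j < K.+1) hit j w * 1).
    exact: summable_sum.
  have EN : \1_N = (fun w => 1 + (- 1) * \sum_(1 <= j < K.+1) hit j w * 1) :> (Omega -> R).
    apply/funext => w; rewrite indicE /N.
    have [kK|kK] := boolP (1 <= khat w <= K)%N.
      rewrite (sum1 (fun=> 1)) // mulN1r subrr memNset //=.
      by rewrite kK.
    rewrite mem_set //= big1_seq ?mulr0 ?addr0 // => j /andP[_].
    rewrite mem_index_iota ltnS /hit => jK; case: eqP => [kj|]; last by rewrite mul0r.
    by rewrite kj jK in kK.
  have : ('E_P[\1_N] = 0)%E.
    rewrite EN unlock -EFin_Ex; last by apply: summableD; [exact: summable_cst|exact: summableZ].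
    rewrite ExD; [|exact: summable_cst|exact: summableZ].
    rewrite Ex_cst (ExZ _ iS1) Ex_sum // (eq_big_nat _ _ (F2 := fun=> K%:R^-1)).
      2: by move=> j jK; rewrite (hit_mean (Z := fun=> 1)) ?Ex_cst ?mulr1 //; exact: summable_cst.
    rewrite sumr_const_nat subSS subn0 -[_ *+ K]mulr_natr mulVf ?gt_eqF //.
    by rewrite mulr1 subrr.
  by rewrite expectation_indic.
have mX : measurable_fun setT (fun w => enorm (S (khat w) w)).
  move=> _ B mB; rewrite setTI.
  have -> : (fun w => enorm (S (khat w) w)) @^-1` B =
      \bigcup_j (khat @^-1` [set j] `&` (fun w => enorm (S j w)) @^-1` B).
    apply/seteqP; split=> [w Bw|w [j _ [/= <-]]] //.
    by exists (khat w).
  apply: bigcupT_measurable => j; apply: measurableI.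
    exact: measurable_funPTI.
  by rewrite -[X in measurable X]setTI; exact: mZO.
have ae_le : {ae P, forall w, enorm (S (khat w) w) <= Y w}.
  exists N; split => // w /= h; apply: contra_notT h; rewrite negbK => kK.
  by rewrite /Y (sum1 (fun j => enorm (S j w))).
have Y0 w : 0 <= Y w.
  by apply: sumr_ge0 => j _; rewrite mulr_ge0 ?ler0n ?enorm_ge0.
have mY := summable_measurable iYs.
apply: le_trans (expectation_le mX mY _ Y0 ae_le) _; first by move=> w; exact: enorm_ge0.
by rewrite unlock -EFin_Ex // lee_fin.
Qed.

End random_output.

(** * The complexity bound *)

Theorem corollaryB5 (R : realType) (d p0 : nat)
  (dXi : measure_display) (Xi : measurableType dXi) (PXi : probability Xi R)
  (f : 'cV[R]_d -> R) (ft : 'cV[R]_d -> Xi -> R)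
  (G : 'cV[R]_d -> Xi -> 'cV[R]_d)
  (A : 'M[R]_(p0, d)) (b : 'cV[R]_p0)
  (Lf V delta c1 c2 c3 c4 c m rho eta k0 : R)
  (eta_ alpha_ : nat -> R)
  (x0 : 'cV[R]_d) (lambda0 : 'cV[R]_p0) (g0 : 'cV[R]_d)
  (f_diff : forall x, differentiable f x)
  (ft_int : forall x, PXi.-integrable setT (EFin \o ft x))
  (f_mean : forall x, ('E_PXi[ft x] = (f x)%:E)%E)
  (A_neq0 : A != 0)
  (feasible : exists x, A *m x = b)
  (G_meas : jointly_measurable G)
  (G_int : forall x i,
    PXi.-integrable setT (fun xi => (G x xi i ord0)%:E))
  (G_mean : forall x i,
    ('E_PXi[fun xi => G x xi i ord0] = (gradient f x i ord0)%:E)%E)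
  (delta_def : smallest_nonzero_eigenvalue (A^T *m A) delta)
  (Lf_gt0 : 0 < Lf)
  (c1_gt0 : 0 < c1) (c2_gt0 : 0 < c2) (c3_gt0 : 0 < c3) (c4_gt0 : 0 < c4)
  (c_def : c = 121 * Lf ^+ 2)
  (m_def : m = Num.min (1 / (448 * Lf))
              (Num.min (1 / (32 * (1 + c2 + c3) * Lf))
                       (1 / (8 * (1 + 2 * c3) * Lf))))
  (rho_def : rho = Num.max (7 * (1 + c1) / (m * delta))
                  (Num.max (4 * (6 + c4) * (1 + c1) * Lf / delta)
                           (168 * (1 + c1) * Lf / delta)))
  (eta_def : eta = 1 / (11 * (Lf + rho * spectral_norm A ^+ 2)))
  (k0_def : k0 = Num.max ((10 * m / (3 * c1 * eta)) ^+ 2)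
                (Num.max ((20 / (3 * eta * c2 * Lf)) ^+ 2)
                (Num.max ((10 / (3 * eta * c3 * Lf)) ^+ 2)
                (Num.max (400 / (3 * eta ^+ 2 * c4 * Lf ^+ 2))
                (Num.max ((20 / (c * eta ^+ 2)) ^+ 4)
                (Num.max ((50 / (3 * c * eta ^+ 2)) ^+ 6) 2))))))
  (eta_k_def : forall k : nat,
    eta_ k = eta / ((k%:R + k0) `^ (1 / 3) * ln (k%:R + k0)))
  (alpha_k_def : forall k : nat, alpha_ k = c * eta_ k ^+ 2)
  (G_lip : forall u v,
    ('E_PXi[fun xi => (enorm (G u xi - G v xi) ^+ 2)%R]
       <= (Lf ^+ 2 * enorm (u - v) ^+ 2)%R%:E)%E)
  (G_var : forall x,
    ('E_PXi[fun xi => (enorm (G x xi - gradient f x) ^+ 2)%R] <= (V ^+ 2)%R%:E)%E)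
  (f_ge0 : forall x, 0 <= f x) :
  exists C p : R, [/\ 0 < C, 0 < p &
    forall eps : R, 0 < eps <= 1 / 2 ->
    exists K : nat, [/\ (0 < K)%N,
      K%:R <= C * eps ^- 3 * ln (1 / eps) `^ p &
      forall (dO : measure_display) (Omega : measurableType dO)
        (P : probability Omega R)
        (xi : nat -> {mfun Omega >-> Xi}) (khat : {mfun Omega >-> nat}),
      sample_sequence P PXi xi ->
      uniform_output_index P xi K khat ->
      let run (w : Omega) (k : nat) : state R p0 d :=
        slalm A b G rho eta_ alpha_ (State x0 lambda0 g0)
          (fun j => xi j w) k in
      let xbar (w : Omega) := primal (run w (khat w)) in
      let lambdabar (w : Omega) := dual (run w (khat w)) in
      ('E_P[fun w => enorm (gradient f (xbar w) + A^T *m lambdabar w)%R]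
         <= eps%:E)%E /\
      ('E_P[fun w => enorm (A *m xbar w - b)%R] <= eps%:E)%E]].
Proof.
have [delta_gt0 _] := spectral_gap x0 delta_def.
have m_gt0 : 0 < m.
  have c23 : 0 < 1 + c2 + c3 by lra.
  have c3' : 0 < 1 + 2 * c3 by lra.
  by rewrite m_def !lt_min !divr_gt0 ?mulr_gt0 ?ltr0n ?ltr01.
have mL : m * Lf <= 1 / 448.
  have Lp : 0 < 448 * Lf by rewrite mulr_gt0 ?ltr0n.
  have : m <= 1 / (448 * Lf) by rewrite m_def ge_min lexx.
  by rewrite (ler_pdivlMr _ _ Lp); lra.
have rho_ge : 7 * (1 + c1) <= rho * m * delta.
  rewrite -mulrA -ler_pdivrMr ?mulr_gt0 //.
  by rewrite rho_def le_max lexx.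
have rho_gt0 : 0 < rho.
  rewrite rho_def lt_max divr_gt0 // ?mulr_gt0 //; lra.
have eta_gt0 : 0 < eta.
  rewrite eta_def divr_gt0 // mulr_gt0 // ltr_wpDr // mulr_ge0 ?sqr_ge0 //.
  exact: ltW.
have k0_ge2 : 2 <= k0 by rewrite k0_def !le_max lexx !orbT.
have alphaE k : alpha_ k = 121 * Lf ^+ 2 * eta_ k ^+ 2 by rewrite alpha_k_def c_def.
have step0 := step_gt0 eta_gt0 k0_ge2 eta_k_def.
have step_ni := step_le eta_gt0 k0_ge2 eta_k_def.
pose s0 := State x0 lambda0 g0.
have [C C0 hC] := ergodic_bound s0 f_diff f_ge0 G_meas G_int G_mean G_lip G_var
  feasible delta_def Lf_gt0 m_gt0 rho_gt0 c1_gt0 mL rho_ge step0 step_ni alphaE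
  (step_small eta_gt0 k0_ge2 eta_k_def) (step_inv_increment eta_gt0 k0_ge2 eta_k_def)
  (step_cubes eta_gt0 k0_ge2 eta_k_def).
have [M M0 hM] := iteration_count eta_gt0 k0_ge2 eta_k_def C0.
exists M, 3%:R; split => // eps eps01.
have [K [K0 KM KC]] := hM eps eps01; have [eps0 epsh] := andP eps01.
exists K; split => //.
  rewrite powR_mulrn // ln_ge0 // ler_pdivlMr //; lra.
move=> dO Omega P xi khat iid unif.
have [sumS sumR] := hC _ _ P xi iid K K0.
have mom k := run_moments A b rho eta_ alpha_ s0 G_meas G_int G_mean G_lip G_var k.
have my i : measurable_fun setT (fun w : run_space xi => xi i w).
  exact: measurable_sample_run.
have mrun k := vmeas_run A b rho eta_ alpha_ s0 G_meas
  (ys := fun (w : run_space xi) i => xi i w) (k := k) (fun i _ => my i).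
move=> run xbar lambdabar; split.
- apply: (output_mean K0 unif (S := fun j w =>
    stationarity f G A b rho eta_ alpha_ s0 (fun i => xi i w) j)) => //.
  + move=> j; have [mX mLm _] := mrun j.
    apply: vmeasD (vmeas_mulmx _ mLm) => i.
    apply: (@measurable_continuous_comp _ _ _ _ (fun x => gradient f x i ord0)) mX.
    exact: (gradient_continuous G_meas G_int G_mean G_lip).
  + move=> j; apply: (bounded_moment_L2v (Z := fun y =>
      stationarity f G A b rho eta_ alpha_ s0 y j) iid).
    exact: bounded_moment_stationarity.
  + exact: le_trans sumS KC.
- apply: (output_mean K0 unif (S := fun j w =>
    residual A b G rho eta_ alpha_ s0 (fun i => xi i w) j)) => //.
  + move=> j; have [mX _ _] := mrun j.
    by apply: vmeasD (vmeas_mulmx _ mX) _; exact: vmeas_cst.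
  + move=> j; apply: (bounded_moment_L2v (Z := fun y =>
      residual A b G rho eta_ alpha_ s0 y j) iid).
    have [bX _ _] := mom j; apply: bounded_momentD; first exact: bounded_momentM.
    exact: bounded_moment_cst.
  + exact: le_trans sumR KC.
Qed.
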